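(* Let $\alpha\ge 0$ and let $f\in\mathcal{W}(\alpha)$. Then the first three logarithmic coefficients $\gamma_1,\gamma_2,\gamma_3$ of $f$ satisfy $$|\gamma_1|\le \frac{1}{2(1+\alpha)},\qquad |\gamma_2|\le \frac{1}{3(1+2\alpha)},\qquad |\gamma_3|\le \frac{1}{4(1+3\alpha)}.$$ Each of these three estimates is sharp.
   Context: Let $\mathbb{D}=\{z\in\mathbb{C}:|z|<1\}$ and let $\mathcal{A}$ be the class of holomorphic functions $f$ on $\mathbb{D}$ with $f(0)=0$ and $f'(0)=1$, written $f(z)=z+\sum_{n\ge 2}a_nz^n$. For $\alpha\ge 0$, $\mathcal{W}(\alpha)$ is the class of all $f\in\mathcal{A}$ with $\mathrm{Re}\,\{f'(z)+\alpha z f''(z)\}>0$ for all $z\in\mathbb{D}$. It is known that every $f\in\mathcal{W}(\alpha)$ is univalent in $\mathbb{D}$. The logarithmic coefficients $\gamma_n$ of $f$ are defined by $\log\frac{f(z)}{z}=2\sum_{n=1}^\infty\gamma_nz^n$ near $0$ (branch of the logarithm vanishing at $z=0$); in particular $\gamma_1=\frac12a_2$, $\gamma_2=\frac12\left(a_3-\frac12a_2^2\right)$, $\gamma_3=\frac12\left(a_4-a_2a_3+\frac13a_2^3\right)$. An estimate is called sharp if, for every $\alpha\ge0$, equality in it is attained by some $f\in\mathcal{W}(\alpha)$ (possibly a different $f$ for each estimate). *)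

(* Defs.v *)
From Stdlib Require Import Reals ClassicalEpsilon.
From Coquelicot Require Import Coquelicot.

Open Scope R_scope.

Definition in_disc (z : C) : Prop := Cmod z < 1.

(* Functions are total on [C]; only their values on the unit disc matter.
   [ex_derive] is differentiability over the absolute ring [C], that is,
   complex differentiability. *)
Definition holomorphic_on_disc (f : C -> C) : Prop :=
  forall z : C, in_disc z -> ex_derive f z.

Definition class_A (f : C -> C) : Prop :=
  holomorphic_on_disc f /\ f 0 = 0 /\ C_derive f 0 = 1.

(* [C_derive] is Coquelicot's total derivative operator; on the disc it gives
   the complex derivative, since [f] and hence [C_derive f] are holomorphic
   there. *)
Definition class_W (alpha : R) (f : C -> C) : Prop :=
  class_A f /\
  forall z : C, in_disc z ->
    0 < Re (C_derive f z + alpha * z * C_derive (C_derive f) z)%C.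

Definition Cexp (z : C) : C :=
  (exp (Re z) * cos (Im z), exp (Re z) * sin (Im z)).

(* [L] is the branch, vanishing at 0, of log (f(z)/z) on the disc |z| < r.
   The point z = 0, where f(z)/z has a removable singularity with value 1, is
   covered by [L 0 = 0] and continuity. *)
Definition is_log_branch (f : C -> C) (r : R) (L : C -> C) : Prop :=
  L 0 = 0 /\
  forall z : C, Cmod z < r ->
    continuous L z /\ (z <> 0 -> Cexp (L z) = (f z / z)%C).

(* The condition [gamma 0 = 0] makes the power series start at n = 1. *)
Definition is_log_coeffs (f : C -> C) (gamma : nat -> C) : Prop :=
  gamma 0%nat = 0 /\
  exists (r : R) (L : C -> C),
    0 < r /\ is_log_branch f r L /\
    forall z : C, Cmod z < r ->
      is_pseries (fun n : nat => (2 * gamma n)%C) z (L z).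

(* For [f] in [class_A] there is exactly one sequence satisfying
   [is_log_coeffs f]; the description operator selects it. *)
Definition log_coeff (f : C -> C) : nat -> C :=
  epsilon (inhabits (fun _ : nat => RtoC 0)) (is_log_coeffs f).

(* Main.v *)
Require Import Defs.
From Stdlib Require Import Reals Lra Lia Psatz ClassicalEpsilon.
From Coquelicot Require Import Coquelicot.

Open Scope R_scope.

(** Write [f z = z + a2 z^2 + ...] and [p = f' + alpha z f''], a function with
    positive real part and [p 0 = 1]. Its coefficients [c n] are
    [(n + 1) (1 + alpha n) a (n + 1)], so the logarithmic coefficients of [f]
    are polynomials in [c 1], [c 2], [c 3]:

    - [gamma1] is a multiple of [c 1];
    - [gamma2] is a multiple of [c 2 - mu c1^2] with [0 <= mu <= 1];
    - [gamma3] is a multiple of [c 3 - 2 B c1 c2 + D c1^3] with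
      [0 <= D <= B] and [1 + D - 2 B >= 0].

    For functions with positive real part the quantities [c 1], [c 2],
    [c 2 - c1^2], [c 3], [c 3 - c1 c2] and [c 3 - 2 c1 c2 + c1^3] all have
    modulus at most 2 ([caratheodory_bounds]). The functional for [gamma2] is a
    convex combination of the second and third, the one for [gamma3] of the
    last three, with weights [1 + D - 2 B], [2 (B - D)] and [D]. This gives the
    bounds ([log_coeff_bounds]).

    The six inequalities have one source. On a circle of radius [r < 1], [Re p]
    is the density of a probability measure, and [e = exp (- i t)] has moments
    [c n r^n / 2] for [n > 0]. The quantities above, rescaled by a power of [r], are twice
    the means of [e^j (e - m)^k] with [m = c1 r] and [k <= 2]. Since [e - m]
    has mean square 1, these means are at most 1 in modulus.

    Equality holds when [p = (1 + z^n) / (1 - z^n)] with [n = 1, 2, 3]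
    ([extremal_function]).

    All of this needs that holomorphic functions are power series, which is
    derived from complex differentiability alone. Goursat's theorem for
    rectangles ([goursat_rect]), in the coordinate [log w], says that the mean
    of a holomorphic function over a circle does not depend on the radius
    ([circle_mean_annulus]). This yields the mean value property, the Cauchy
    formula and the Taylor series ([taylor]). Power series are differentiated
    termwise ([has_ps_derive]), their coefficients are unique
    ([has_ps_unique]), and a logarithm of [f z / z] is found by integrating a
    series ([power_series_log]); the polynomial expressions of the logarithmic
    coefficients follow ([log_coeff_values]). *)

(** * Complex differentiability in terms of the modulus *)

Notation CR := C_R_CompleteNormedModule.

Lemma norm_CR_Cmod (z : C) : norm (V := C_R_NormedModule) z = Cmod z.
Proof.
  change (sqrt (Rabs (fst z) ^ 2 + Rabs (snd z) ^ 2) = Cmod z).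
  rewrite !pow2_abs. reflexivity.
Qed.

Lemma locally_Cmod (z : C) (P : C -> Prop) :
  locally (T := C_UniformSpace) z P <->
  exists d, 0 < d /\ forall w, Cmod (w - z) < d -> P w.
Proof.
  split.
  - intros H. apply locally_C in H. destruct H as [d Hd].
    exists d; split; [apply cond_pos|]. intros w Hw; apply Hd. exact Hw.
  - intros [d [Hd H]]. apply locally_C. exists (mkposreal d Hd). intros w Hw. apply H, Hw.
Qed.

Lemma continuous_Cmod (f : C -> C) (z : C) :
  continuous (T := C_UniformSpace) (U := C_UniformSpace) f z <->
  forall eps, 0 < eps -> exists d, 0 < d /\
    forall w, Cmod (w - z) < d -> Cmod (f w - f z) < eps.
Proof.
  split.
  - intros H eps He. apply locally_Cmod. apply (H (fun u => Cmod (u - f z) < eps)).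
    apply locally_Cmod. exists eps; auto.
  - intros H P HP. apply locally_Cmod in HP. destruct HP as [e [He HP]].
    destruct (H e He) as [d [Hd H1]]. apply locally_Cmod. exists d; split; auto.
Qed.

(** The derivative is taken with values in the normed module over [C] used in
    the definition of holomorphy; the algebraic rules of the general theory
    live on the regular module of the ring, hence [cderive_AbsRing] below. *)
Definition cderive (f : C -> C) (z l : C) : Prop :=
  is_derive (K := C_AbsRing) (V := C_NormedModule) f z l.

Lemma cderive_eps (f : C -> C) (z l : C) :
  cderive f z l <->
  forall eps, 0 < eps -> exists d, 0 < d /\
    forall w, Cmod (w - z) < d ->
      Cmod (f w - f z - l * (w - z)) <= eps * Cmod (w - z).
Proof.
  assert (Hl : forall w, minus (minus (f w) (f z)) (scal (minus w z) l) = (f w - f z - l * (w - z))%C).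
  { intros w. unfold minus, plus, opp, scal; simpl. unfold mult; simpl. ring. }
  split.
  - intros [_ H] eps He.
    specialize (H z (fun P HP => HP) (mkposreal eps He)). simpl in H.
    destruct H as [d H]. exists d; split; [apply cond_pos|].
    intros w Hw. specialize (H w Hw). simpl in H.
    unfold norm in H; simpl in H.
    rewrite Hl in H. exact H.
  - intros H. split. apply is_linear_scal_l.
    intros x Hx.
    apply (is_filter_lim_locally_unique (K := C_AbsRing)
      (V := AbsRing_NormedModule C_AbsRing)) in Hx. subst x.
    intros eps. destruct (H eps (cond_pos eps)) as [d [Hd H1]].
    exists (mkposreal d Hd). intros w Hw. specialize (H1 w Hw).
    unfold norm; simpl. rewrite Hl. exact H1.
Qed.

Lemma cderive_AbsRing (f : C -> C) (z l : C) :
  cderive f z l <-> is_derive (K := C_AbsRing) (V := AbsRing_NormedModule C_AbsRing) f z l.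
Proof. split; intros [_ H]; (split; [apply is_linear_scal_l | exact H]). Qed.

Lemma cderive_continuous f z l : cderive f z l ->
  continuous (T := C_UniformSpace) (U := C_UniformSpace) f z.
Proof.
  intros H. apply continuous_Cmod. intros eps He.
  rewrite cderive_eps in H. destruct (H 1 Rlt_0_1) as [d [Hd H1]].
  assert (Hl := Cmod_ge_0 l).
  exists (Rmin d (eps / (2 + Cmod l))). split.
  { apply Rmin_pos; auto. apply Rdiv_lt_0_compat; lra. }
  intros w Hw. specialize (H1 w (Rlt_le_trans _ _ _ Hw (Rmin_l _ _))).
  assert (H2 := Rlt_le_trans _ _ _ Hw (Rmin_r _ _)).
  replace (f w - f z)%C with ((f w - f z - l * (w - z)) + l * (w - z))%C by ring.
  eapply Rle_lt_trans. apply Cmod_triangle. rewrite Cmod_mult.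
  assert (H3 := Cmod_ge_0 (w - z)).
  apply Rlt_le_trans with ((2 + Cmod l) * (eps / (2 + Cmod l))).
  2: right; field; lra.
  apply Rle_lt_trans with ((1 + Cmod l) * Cmod (w - z)). lra.
  apply Rle_lt_trans with ((1 + Cmod l) * (eps / (2 + Cmod l))).
  apply Rmult_le_compat_l; lra.
  apply Rmult_lt_compat_r. apply Rdiv_lt_0_compat; lra. lra.
Qed.

Lemma cderive_ext_loc f g z l :
  (exists d, 0 < d /\ forall w, Cmod (w - z) < d -> f w = g w) ->
  cderive f z l -> cderive g z l.
Proof.
  intros [d [Hd H]]. apply is_derive_ext_loc. exists (mkposreal d Hd). intros w Hw; apply H, Hw.
Qed.

Lemma cderive_const (c z : C) : cderive (fun _ => c) z 0.
Proof. apply (is_derive_const (K := C_AbsRing) (V := C_NormedModule)). Qed.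

Lemma cderive_id (z : C) : cderive (fun w => w) z 1.
Proof. apply cderive_AbsRing, (is_derive_id (K := C_AbsRing)). Qed.

Lemma cderive_plus f g z l m : cderive f z l -> cderive g z m ->
  cderive (fun w => f w + g w)%C z (l + m).
Proof. apply (is_derive_plus (K := C_AbsRing) (V := C_NormedModule)). Qed.

Lemma cderive_opp f z l : cderive f z l -> cderive (fun w => - f w)%C z (- l).
Proof. apply (is_derive_opp (K := C_AbsRing) (V := C_NormedModule)). Qed.

Lemma cderive_minus f g z l m : cderive f z l -> cderive g z m ->
  cderive (fun w => f w - g w)%C z (l - m).
Proof. apply (is_derive_minus (K := C_AbsRing) (V := C_NormedModule)). Qed.

Lemma cderive_mult f g z l m : cderive f z l -> cderive g z m ->
  cderive (fun w => f w * g w)%C z (l * g z + f z * m).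
Proof.
  rewrite !cderive_AbsRing. intros Hf Hg.
  apply (is_derive_mult (K := C_AbsRing) f g z l m Hf Hg). apply Cmult_comm. Qed.

Lemma cderive_comp f g z l m : cderive f (g z) l -> cderive g z m ->
  cderive (fun w => f (g w)) z (m * l).
Proof.
  rewrite (cderive_AbsRing g). apply (is_derive_comp (K := C_AbsRing) (V := C_NormedModule)).
Qed.

Lemma cderive_eq f z l m : cderive f z l -> l = m -> cderive f z m.
Proof. intros H <-; exact H. Qed.

Lemma cderive_Cinv (z : C) : z <> 0 -> cderive Cinv z (- / (z * z)).
Proof.
  intros Hz. apply cderive_eps. intros eps He.
  assert (Hp : 0 < Cmod z) by (apply Cmod_gt_0; auto).
  set (m := Cmod z) in *.
  exists (Rmin (m / 2) (eps * (m * m * m) / 2)). split.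
  { apply Rmin_pos. lra. apply Rdiv_lt_0_compat; try lra. repeat apply Rmult_lt_0_compat; auto. }
  intros w Hw. assert (H1 := Rlt_le_trans _ _ _ Hw (Rmin_l _ _)).
  assert (H2 := Rlt_le_trans _ _ _ Hw (Rmin_r _ _)).
  assert (Hwm : m / 2 < Cmod w).
  { assert (m <= Cmod (w - z) + Cmod w). unfold m.
    replace z with (- (w - z) + w)%C at 1 by ring.
    eapply Rle_trans. apply Cmod_triangle. rewrite Cmod_opp. lra. lra. }
  assert (Hw0 : w <> 0). { intros ->. rewrite Cmod_0 in Hwm. lra. }
  replace (/ w - / z - - / (z * z) * (w - z))%C with ((w - z) * ((w - z) * (/ w * (/ z * / z))))%C by (field; auto).
  rewrite !Cmod_mult, !Cmod_inv by auto. fold m.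
  rewrite Rmult_comm. apply Rmult_le_compat_r. apply Cmod_ge_0.
  apply Rle_trans with (eps * (m * m * m) / 2 * (/ (m / 2) * (/ m * / m))).
  2: right; field; lra.
  apply Rmult_le_compat; try lra. apply Cmod_ge_0.
  { assert (0 < / m) by (apply Rinv_0_lt_compat; auto).
    apply Rmult_le_pos. left; apply Rinv_0_lt_compat; lra. nra. }
  apply Rmult_le_compat_r. assert (0 < / m) by (apply Rinv_0_lt_compat; auto). nra.
  apply Rinv_le_contravar; lra.
Qed.

Lemma cderive_inv f z l : cderive f z l -> f z <> 0 ->
  cderive (fun w => / f w)%C z (- l / (f z * f z)).
Proof.
  intros H H0. eapply cderive_eq. apply (cderive_comp Cinv f z); eauto. apply cderive_Cinv; auto.
  unfold Cdiv. ring.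
Qed.

Lemma cderive_div f g z l m : cderive f z l -> cderive g z m -> g z <> 0 ->
  cderive (fun w => f w / g w)%C z ((l * g z - f z * m) / (g z * g z)).
Proof.
  intros Hf Hg H0. eapply cderive_eq. apply cderive_mult; eauto. apply cderive_inv; eauto.
  cbv beta. field; auto.
Qed.

Lemma Cexp_plus a b : Cexp (a + b) = (Cexp a * Cexp b)%C.
Proof.
  apply injective_projections; unfold Re, Im; simpl;
    rewrite ?exp_plus, ?cos_plus, ?sin_plus; unfold Re, Im; simpl; ring.
Qed.

Lemma Cexp_0 : Cexp 0 = 1.
Proof. unfold Cexp; simpl. rewrite exp_0, cos_0, sin_0. apply injective_projections; simpl; ring. Qed.

Lemma Cmod_Cexp z : Cmod (Cexp z) = exp (Re z).
Proof.
  unfold Cmod. rewrite <- (sqrt_square (exp (Re z))) by (left; apply exp_pos).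
  f_equal. assert (H := sin2_cos2 (Im z)). unfold Rsqr in H.
  replace (exp (Re z) * exp (Re z))
    with (exp (Re z) * exp (Re z) * (sin (Im z) * sin (Im z) + cos (Im z) * cos (Im z)))
    by (rewrite H; ring).
  unfold Cexp; simpl. ring.
Qed.

Lemma Cmod_le_Rabs z : Cmod z <= Rabs (Re z) + Rabs (Im z).
Proof.
  unfold Cmod.
  assert (H1 := Rabs_pos (Re z)). assert (H2 := Rabs_pos (Im z)).
  rewrite <- (sqrt_square (Rabs (Re z) + Rabs (Im z))) by lra.
  apply sqrt_le_1_alt. unfold Re, Im in *.
  rewrite <- (pow2_abs (fst z)), <- (pow2_abs (snd z)). nra.
Qed.

Lemma Rabs_Im_le z : Rabs (Im z) <= Cmod z.
Proof. eapply Rle_trans; [|apply Rmax_Cmod]. apply Rmax_r. Qed.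

Lemma is_derive_0_eps (f : R -> R) l : is_derive f 0 l -> forall eps, 0 < eps ->
  exists d, 0 < d /\ forall x, Rabs x < d -> Rabs (f x - f 0 - l * x) <= eps * Rabs x.
Proof.
  intros [_ H] eps He. specialize (H 0 (fun P HP => HP) (mkposreal eps He)).
  destruct H as [d H]. exists d; split. apply cond_pos.
  intros x Hx. specialize (H x).
  assert (Hb : ball (M := R_UniformSpace) 0 d x).
  { unfold ball; simpl. unfold AbsRing_ball, abs, minus, plus, opp; simpl.
    now rewrite Ropp_0, Rplus_0_r. }
  specialize (H Hb). unfold norm in H; simpl in H.
  unfold abs, minus, plus, opp, scal in H; simpl in H. unfold mult in H; simpl in H.
  rewrite Ropp_0, !Rplus_0_r in H. unfold Rminus. replace (l * x) with (x * l) by ring. exact H.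
Qed.

(** First-order expansions of exp, cos and sin at 0 suffice:
    [exp x * cos y - 1 - x = (exp x - 1 - x) + exp x * (cos y - 1)] and
    [exp x * sin y - y = exp x * (sin y - y) + (exp x - 1) * y], where every
    term is small compared with [|x| + |y|]. *)
Lemma cderive_Cexp_0 : cderive Cexp 0 1.
Proof.
  apply cderive_eps. intros eps He. rewrite Cexp_0.
  set (e := Rmin 1 (eps / 8)).
  assert (e0 : 0 < e) by (apply Rmin_pos; lra).
  assert (e1 : e <= 1) by apply Rmin_l. assert (e2 : e <= eps / 8) by apply Rmin_r.
  destruct (is_derive_0_eps exp 1) with (eps := e) as [d1 [D1 H1]]; auto.
  { replace 1 with (exp 0) by apply exp_0. apply is_derive_exp. }
  destruct (is_derive_0_eps sin 1) with (eps := e) as [d2 [D2 H2]]; auto.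
  { replace 1 with (cos 0) by apply cos_0. apply is_derive_sin. }
  destruct (is_derive_0_eps cos 0) with (eps := e) as [d3 [D3 H3]]; auto.
  { replace 0 with (- sin 0) at 2 by (rewrite sin_0; ring). apply is_derive_cos. }
  rewrite exp_0 in H1. rewrite sin_0 in H2. rewrite cos_0 in H3.
  exists (Rmin (e / 2) (Rmin d1 (Rmin d2 d3))). split.
  { repeat apply Rmin_pos; auto. lra. }
  intros w Hw. replace (w - 0)%C with w in * by ring.
  assert (W := Rlt_le_trans _ _ _ Hw (Rmin_l _ _)).
  assert (W' := Rlt_le_trans _ _ _ Hw (Rmin_r _ _)). clear Hw.
  assert (W1 := Rlt_le_trans _ _ _ W' (Rmin_l _ _)).
  assert (W'' := Rlt_le_trans _ _ _ W' (Rmin_r _ _)).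
  assert (W2 := Rlt_le_trans _ _ _ W'' (Rmin_l _ _)).
  assert (W3 := Rlt_le_trans _ _ _ W'' (Rmin_r _ _)). clear W' W''.
  assert (Rx := re_le_Cmod w). assert (Ry := Rabs_Im_le w).
  assert (Hm := Cmod_ge_0 w).
  specialize (H1 (Re w)). specialize (H2 (Im w)). specialize (H3 (Im w)).
  assert (H1' := H1 ltac:(lra)). assert (H2' := H2 ltac:(lra)). assert (H3' := H3 ltac:(lra)). clear H1 H2 H3.
  eapply Rle_trans. apply Cmod_le_Rabs.
  set (x := Re w) in *. set (y := Im w) in *.
  assert (Ex : Rabs (exp x - 1) <= 2 * Rabs x).
  { replace (exp x - 1) with ((exp x - 1 - 1 * x) + x) by ring. eapply Rle_trans. apply Rabs_triang.
    assert (0 <= Rabs x) by apply Rabs_pos. nra. }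
  assert (Ex2 : 0 < exp x <= 2).
  { split. apply exp_pos. apply Rabs_le_between in Ex. lra. }
  replace (Re _) with ((exp x - 1 - 1 * x) + exp x * (cos y - 1 - 0 * y)).
  2: { unfold Cexp, x, y, Re, Im; simpl. ring. }
  replace (Im _) with (exp x * (sin y - 0 - 1 * y) + (exp x - 1) * y).
  2: { unfold Cexp, x, y, Re, Im; simpl. ring. }
  assert (T1 := Rabs_triang (exp x - 1 - 1 * x) (exp x * (cos y - 1 - 0 * y))).
  assert (T2 := Rabs_triang (exp x * (sin y - 0 - 1 * y)) ((exp x - 1) * y)).
  rewrite Rabs_mult, (Rabs_pos_eq (exp x)) in T1 by lra.
  rewrite !Rabs_mult, (Rabs_pos_eq (exp x)) in T2 by lra.
  assert (0 <= Rabs x) by apply Rabs_pos. assert (0 <= Rabs y) by apply Rabs_pos.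
  assert (exp x * Rabs (cos y - 1 - 0 * y) <= 2 * (e * Rabs y)).
  { apply Rmult_le_compat; try lra. apply Rabs_pos. }
  assert (exp x * Rabs (sin y - 0 - 1 * y) <= 2 * (e * Rabs y)).
  { apply Rmult_le_compat; try lra. apply Rabs_pos. }
  assert (Rabs (exp x - 1) * Rabs y <= e * Rabs y). { apply Rmult_le_compat_r; lra. }
  assert (e * Rabs x <= e * Cmod w) by (apply Rmult_le_compat_l; lra).
  assert (e * Rabs y <= e * Cmod w) by (apply Rmult_le_compat_l; lra).
  assert (e * Cmod w <= eps / 8 * Cmod w) by (apply Rmult_le_compat_r; lra).
  assert (0 <= eps * Cmod w) by (apply Rmult_le_pos; lra). lra.
Qed.

Lemma cderive_Cexp z : cderive Cexp z (Cexp z).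
Proof.
  apply (cderive_ext_loc (fun w => Cexp z * Cexp (w - z))%C).
  { exists 1; split; [lra|]. intros w _. rewrite <- Cexp_plus. f_equal. ring. }
  eapply cderive_eq. apply cderive_mult. apply cderive_const.
  apply (cderive_comp Cexp (fun w => w - z)%C).
  replace (z - z)%C with (RtoC 0) by ring. apply cderive_Cexp_0.
  apply cderive_minus. apply cderive_id. apply cderive_const. cbv beta. ring.
Qed.

(** * Goursat's theorem for rectangles *)

Definition cdiff (f : C -> C) (z : C) : Prop :=
  ex_derive (K := C_AbsRing) (V := C_NormedModule) f z.
Definition ccont (f : C -> C) (z : C) : Prop :=
  continuous (T := C_UniformSpace) (U := C_UniformSpace) f z.
Definition rcont (f : R -> C) (t : R) : Prop :=
  continuous (T := R_UniformSpace) (U := C_UniformSpace) f t.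
Definition intC (f : R -> C) (a b : R) : C := RInt (V := CR) f a b.

Lemma cdiff_ccont f z : cdiff f z -> ccont f z.
Proof. intros [l H]. exact (cderive_continuous f z l H). Qed.

Lemma cdiff_const c z : cdiff (fun _ => c) z.
Proof. exists (RtoC 0). apply cderive_const. Qed.

Lemma cdiff_id z : cdiff (fun w => w) z.
Proof. exists (RtoC 1). apply cderive_id. Qed.

Lemma cdiff_minus f g z : cdiff f z -> cdiff g z -> cdiff (fun w => f w - g w)%C z.
Proof. intros [l Hl] [m Hm]. eexists. apply cderive_minus; eassumption. Qed.

Lemma cdiff_mult f g z : cdiff f z -> cdiff g z -> cdiff (fun w => f w * g w)%C z.
Proof. intros [l Hl] [m Hm]. eexists. apply cderive_mult; eassumption. Qed.

Lemma cdiff_div f g z : cdiff f z -> cdiff g z -> g z <> 0 -> cdiff (fun w => f w / g w)%C z.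
Proof. intros [l Hl] [m Hm] H. eexists. apply cderive_div; eassumption. Qed.

Lemma cdiff_pow f n z : cdiff f z -> cdiff (fun w => f w ^ n)%C z.
Proof. intros H; induction n. apply (cdiff_const 1). now apply cdiff_mult. Qed.

Lemma rcont_hline y t : rcont (fun x => (x, y)) t.
Proof.
  intros P [d H]. exists d. intros x Hx. apply H. split; [exact Hx | apply ball_center].
Qed.

Lemma rcont_vline x t : rcont (fun y => (x, y)) t.
Proof.
  intros P [d H]. exists d. intros y Hy. apply H. split; [apply ball_center | exact Hy].
Qed.

Lemma rcont_comp (f : C -> C) (g : R -> C) t : rcont g t -> ccont f (g t) ->
  rcont (fun s => f (g s)) t.
Proof. apply (continuous_comp (U := R_UniformSpace) (V := C_UniformSpace) (W := C_UniformSpace)). Qed.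

Lemma ex_intC f a b : a <= b -> (forall t, a <= t <= b -> rcont f t) ->
  ex_RInt (V := CR) f a b.
Proof.
  intros Hab H. apply ex_RInt_continuous. intros t Ht.
  rewrite Rmin_left, Rmax_right in Ht by lra. exact (H t Ht).
Qed.

Lemma intC_Chasles f a b c : a <= b -> b <= c -> (forall t, a <= t <= c -> rcont f t) ->
  (intC f a b + intC f b c)%C = intC f a c.
Proof.
  intros Hab Hbc H. apply (RInt_Chasles (V := CR) f a b c); apply ex_intC; auto;
  intros t Ht; apply H; lra.
Qed.

Lemma intC_minus_const_bound f c a b M : a <= b -> (forall t, a <= t <= b -> rcont f t) ->
  (forall t, a <= t <= b -> Cmod (f t - c) <= M) ->
  Cmod (intC f a b - (b - a)%R * c) <= (b - a) * M.
Proof.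
  intros Hab Hc HM.
  assert (H1 : is_RInt (V := CR) (fun t => minus (f t) c) a b (minus (intC f a b) (scal (b - a) c))).
  { apply (is_RInt_minus (V := CR)). apply RInt_correct, ex_intC; auto. exact (is_RInt_const (V := C_R_NormedModule) a b c). }
  rewrite <- (scal_R_Cmult (b - a) c), <- norm_CR_Cmod.
  refine (norm_RInt_le_const (V := C_R_NormedModule) _ a b _ M Hab _ H1).
  intros t Ht. rewrite norm_CR_Cmod. exact (HM t Ht).
Qed.

Lemma intC_minus f g a b : a <= b -> (forall t, a <= t <= b -> rcont f t) ->
  (forall t, a <= t <= b -> rcont g t) ->
  intC (fun t => f t - g t)%C a b = (intC f a b - intC g a b)%C.
Proof. intros Hab Hf Hg. apply (RInt_minus (V := CR)); apply ex_intC; auto. Qed.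

(** The integral of [H] along the positively oriented boundary of
    [[a, b] x [c, d]], the vertical sides carrying the factor [dz = i dy]. *)
Definition boundary_integral (H : C -> C) (a b c d : R) : C :=
  (intC (fun t => H (t, c)) a b - intC (fun t => H (t, d)) a b
   + Ci * (intC (fun t => H (b, t)) c d - intC (fun t => H (a, t)) c d))%C.

Definition in_rect a b c d (z : C) := a <= fst z <= b /\ c <= snd z <= d.

Lemma boundary_integral_split_h H a m b c d : a <= m <= b -> c <= d ->
  (forall z, in_rect a b c d z -> ccont H z) ->
  boundary_integral H a b c d = (boundary_integral H a m c d + boundary_integral H m b c d)%C.
Proof.
  intros Hm Hcd HH. unfold boundary_integral.
  rewrite <- (intC_Chasles (fun t => H (t, c)) a m b), <- (intC_Chasles (fun t => H (t, d)) a m b); try lra.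
  ring.
  all: intros t Ht; apply (rcont_comp H); [apply rcont_hline|apply HH; split; simpl; lra].
Qed.

Lemma boundary_integral_split_v H a b c m d : a <= b -> c <= m <= d ->
  (forall z, in_rect a b c d z -> ccont H z) ->
  boundary_integral H a b c d = (boundary_integral H a b c m + boundary_integral H a b m d)%C.
Proof.
  intros Hab Hm HH. unfold boundary_integral.
  rewrite <- (intC_Chasles (fun t => H (b, t)) c m d), <- (intC_Chasles (fun t => H (a, t)) c m d); try lra.
  ring.
  all: intros t Ht; apply (rcont_comp H); [apply rcont_vline|apply HH; split; simpl; lra].
Qed.

Lemma boundary_integral_quarter H x y w h : 0 <= w -> 0 <= h ->
  (forall z, in_rect x (x + w + w) y (y + h + h) z -> ccont H z) ->
  boundary_integral H x (x + w + w) y (y + h + h) =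
    (boundary_integral H x (x + w) y (y + h) + boundary_integral H x (x + w) (y + h) (y + h + h) +
    (boundary_integral H (x + w) (x + w + w) y (y + h) +
     boundary_integral H (x + w) (x + w + w) (y + h) (y + h + h)))%C.
Proof.
  intros Hw Hh Hc.
  rewrite (boundary_integral_split_h H x (x + w) (x + w + w)); [|lra|lra|exact Hc].
  rewrite (boundary_integral_split_v H x (x + w) y (y + h)),
    (boundary_integral_split_v H (x + w) (x + w + w) y (y + h)); try lra.
  reflexivity.
  all: intros z [Z1 Z2]; apply Hc; split; lra.
Qed.

(** An affine function has boundary integral 0, so only the error term of the
    linear approximation contributes: it is at most [eps] times the diameter
    on a boundary whose length is of the order of the diameter. *)
Lemma boundary_integral_near_affine H a b c d (z0 D : C) eps : a <= b -> c <= d ->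
  in_rect a b c d z0 -> 0 <= eps ->
  (forall z, in_rect a b c d z -> ccont H z) ->
  (forall z, in_rect a b c d z -> Cmod (H z - H z0 - D * (z - z0)) <= eps * Cmod (z - z0)) ->
  Cmod (boundary_integral H a b c d) <= 2 * eps * (b - a + (d - c)) ^ 2.
Proof.
  intros Hab Hcd Hz0 He Hc HD.
  set (s := b - a + (d - c)).
  assert (HD' : forall z, in_rect a b c d z -> Cmod (H z - H z0 - D * (z - z0)) <= eps * s).
  { intros z Hz. eapply Rle_trans. apply HD; auto. apply Rmult_le_compat_l; auto.
    eapply Rle_trans. apply Cmod_le_Rabs. unfold Re, Im; simpl.
    destruct Hz, Hz0. unfold s. apply Rplus_le_compat; apply Rabs_le; lra. }
  assert (E : forall z w, in_rect a b c d z -> in_rect a b c d w ->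
    Cmod ((H z - H w) - D * (z - w)) <= 2 * (eps * s)).
  { intros z w Hz Hw.
    replace (_ - _)%C with ((H z - H z0 - D * (z - z0)) + - (H w - H z0 - D * (w - z0)))%C by ring.
    eapply Rle_trans. apply Cmod_triangle. rewrite Cmod_opp.
    specialize (HD' z Hz) as A1. specialize (HD' w Hw) as A2. lra. }
  unfold boundary_integral. rewrite <- !intC_minus; auto.
  2-5: intros t Ht; apply (rcont_comp H); [apply rcont_hline || apply rcont_vline|apply Hc; split; simpl; lra].
  set (I1 := intC _ a b). set (I2 := intC _ c d).
  assert (B1 : Cmod (I1 - (b - a)%R * (D * (0, c - d)%R)) <= (b - a) * (2 * (eps * s))).
  { apply intC_minus_const_bound; auto.
    - intros t Ht. apply (continuous_minus (V := C_R_NormedModule));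
      apply (rcont_comp H); try (apply rcont_hline); apply Hc; split; simpl; lra.
    - intros t Ht. replace (0, c - d)%R with ((t, c) - (t, d))%C.
      apply E; split; simpl; lra. apply injective_projections; simpl; ring. }
  assert (B2 : Cmod (I2 - (d - c)%R * (D * (b - a, 0)%R)) <= (d - c) * (2 * (eps * s))).
  { apply intC_minus_const_bound; auto.
    - intros t Ht. apply (continuous_minus (V := C_R_NormedModule));
      apply (rcont_comp H); try (apply rcont_vline); apply Hc; split; simpl; lra.
    - intros t Ht. replace (b - a, 0)%R with ((b, t) - (a, t))%C.
      apply E; split; simpl; lra. apply injective_projections; simpl; ring. }
  replace (I1 + Ci * I2)%C with ((I1 - (b - a)%R * (D * (0, c - d)%R)) + Ci * (I2 - (d - c)%R * (D * (b - a, 0)%R)))%C.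
  2: { replace ((b - a, 0)%R) with (RtoC (b - a)) by reflexivity.
       replace ((0, c - d)%R) with (Ci * RtoC (c - d))%C by (apply injective_projections; simpl; ring).
       replace (RtoC (d - c)) with (- RtoC (c - d))%C by (apply injective_projections; simpl; ring).
       ring. }
  eapply Rle_trans. apply Cmod_triangle. rewrite Cmod_mult, Cmod_Ci.
  unfold s in *. nra.
Qed.

Lemma nested_intervals (l u : nat -> R) :
  (forall n, l n <= l (S n)) -> (forall n, u (S n) <= u n) -> (forall n, l n <= u n) ->
  exists x, forall n, l n <= x <= u n.
Proof.
  intros Hl Hu Hlu.
  assert (Ml : forall n k, l n <= l (n + k)%nat).
  { intros n k; induction k. rewrite Nat.add_0_r; lra. rewrite Nat.add_succ_r. eapply Rle_trans; eauto. }
  assert (Mu : forall n k, u (n + k)%nat <= u n).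
  { intros n k; induction k. rewrite Nat.add_0_r; lra. rewrite Nat.add_succ_r. eapply Rle_trans; eauto. }
  assert (B : forall m n, l m <= u n).
  { intros m n. eapply Rle_trans. apply (Ml m n). eapply Rle_trans. apply Hlu. rewrite Nat.add_comm. apply Mu. }
  destruct (completeness (fun x => exists n, x = l n)) as [x [X1 X2]].
  - exists (u 0%nat). intros y [n ->]. apply B.
  - exists (l 0%nat). exists 0%nat; auto.
  - exists x. intros n. split. apply X1. exists n; auto. apply X2. intros y [m ->]. apply B.
Qed.

(** Bisection. A rectangle with nonzero integral has a quarter with at least a
    fourth of it; iterating, nested rectangles shrink to a point where
    differentiability makes the integral smaller than a fixed multiple of the
    area, for any prescribed multiple. *)
Theorem goursat_rect (H : C -> C) a b c d : a < b -> c < d ->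
  (forall z, in_rect a b c d z -> cdiff H z) -> boundary_integral H a b c d = 0.
Proof.
  intros Hab Hcd HH.
  assert (HC : forall z, in_rect a b c d z -> ccont H z) by (intros; apply cdiff_ccont; auto).
  destruct (Ceq_dec (boundary_integral H a b c d) 0) as [|Hn]; auto. exfalso.
  set (K := Cmod (boundary_integral H a b c d)).
  assert (HK : 0 < K) by (apply Cmod_gt_0; auto).
  set (w := fun n : nat => (b - a) / 2 ^ n). set (h := fun n : nat => (d - c) / 2 ^ n).
  assert (P2 : forall n, 0 < 2 ^ n) by (intros; apply pow_lt; lra).
  assert (Wp : forall n, 0 < w n) by (intros; apply Rdiv_lt_0_compat; auto; lra).
  assert (Hp : forall n, 0 < h n) by (intros; apply Rdiv_lt_0_compat; auto; lra).
  assert (WS : forall n, w n = 2 * w (S n)) by (intros; unfold w; simpl; field; apply Rgt_not_eq, P2).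
  assert (HS : forall n, h n = 2 * h (S n)) by (intros; unfold h; simpl; field; apply Rgt_not_eq, P2).
  (* [bad n p]: the rectangle with lower left corner [p] and sides halved [n]
     times still carries the share [K / 4 ^ n] of the boundary integral. *)
  set (bad := fun (n : nat) (p : R * R) =>
    a <= fst p /\ fst p + w n <= b /\ c <= snd p /\ snd p + h n <= d /\
    K / 4 ^ n <= Cmod (boundary_integral H (fst p) (fst p + w n) (snd p) (snd p + h n))).
  assert (step : forall n p, bad n p -> exists q, bad (S n) q /\
    fst p <= fst q /\ fst q + w (S n) <= fst p + w n /\
    snd p <= snd q /\ snd q + h (S n) <= snd p + h n).
  { intros n [x y] (X1 & X2 & Y1 & Y2 & HB). simpl in *.
    specialize (WS n). specialize (HS n). specialize (Wp (S n)). specialize (Hp (S n)).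
    set (w' := w (S n)) in *. set (h' := h (S n)) in *.
    assert (E : boundary_integral H x (x + w n) y (y + h n) =
      (boundary_integral H x (x + w') y (y + h') + boundary_integral H x (x + w') (y + h') (y + h' + h') +
      (boundary_integral H (x + w') (x + w' + w') y (y + h') +
       boundary_integral H (x + w') (x + w' + w') (y + h') (y + h' + h')))%C).
    { replace (x + w n) with (x + w' + w') by lra. replace (y + h n) with (y + h' + h') by lra.
      apply boundary_integral_quarter; try lra. intros z [Z1 Z2]; apply HC; split; lra. }
    rewrite E in HB.
    assert (F : K / 4 ^ n = 4 * (K / 4 ^ S n)). { simpl. field. apply Rgt_not_eq, pow_lt; lra. }
    rewrite F in HB. set (k := K / 4 ^ S n) in *.
    destruct (Rle_lt_dec k (Cmod (boundary_integral H x (x + w') y (y + h')))) as [L1|L1].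
    { exists (x, y). unfold bad. simpl. fold w' h' k. repeat split; auto; lra. }
    destruct (Rle_lt_dec k (Cmod (boundary_integral H x (x + w') (y + h') (y + h' + h')))) as [L2|L2].
    { exists (x, y + h'). unfold bad. simpl. fold w' h' k. repeat split; auto; lra. }
    destruct (Rle_lt_dec k (Cmod (boundary_integral H (x + w') (x + w' + w') y (y + h')))) as [L3|L3].
    { exists (x + w', y). unfold bad. simpl. fold w' h' k. repeat split; auto; lra. }
    destruct (Rle_lt_dec k (Cmod (boundary_integral H (x + w') (x + w' + w') (y + h') (y + h' + h')))) as [L4|L4].
    { exists (x + w', y + h'). unfold bad. simpl. fold w' h' k. repeat split; auto; lra. }
    exfalso.
    match type of HB with _ <= Cmod (?p + ?q + (?r + ?s)) =>
      assert (T1 := Cmod_triangle (p + q) (r + s)); assert (T2 := Cmod_triangle p q);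
      assert (T3 := Cmod_triangle r s) end. lra. }
  assert (bad0 : bad 0%nat (a, c)).
  { unfold bad, w, h; simpl. unfold Rdiv. rewrite Rinv_1, !Rmult_1_r.
    replace (a + (b - a)) with b by ring. replace (c + (d - c)) with d by ring.
    repeat split; lra || (unfold K; lra). }
  set (next := fun n (p : {p | bad n p}) =>
    let s := constructive_indefinite_description _ (step n (proj1_sig p) (proj2_sig p)) in
    exist (bad (S n)) (proj1_sig s) (proj1 (proj2_sig s))).
  set (sq := nat_rect (fun n => {p | bad n p}) (exist _ (a, c) bad0) next).
  set (q := fun n => proj1_sig (sq n)).
  assert (Q1 : forall n, bad n (q n)) by (intros n; exact (proj2_sig (sq n))).
  assert (Q2 : forall n, fst (q n) <= fst (q (S n)) /\ fst (q (S n)) + w (S n) <= fst (q n) + w n /\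
    snd (q n) <= snd (q (S n)) /\ snd (q (S n)) + h (S n) <= snd (q n) + h n).
  { intros n. unfold q; simpl. unfold next; simpl.
    destruct (constructive_indefinite_description _ _) as [p Hp']. simpl. tauto. }
  destruct (nested_intervals (fun n => fst (q n)) (fun n => fst (q n) + w n)) as [x Hx];
    try (intros n; specialize (Q2 n); specialize (Wp n); lra).
  destruct (nested_intervals (fun n => snd (q n)) (fun n => snd (q n) + h n)) as [y Hy];
    try (intros n; specialize (Q2 n); specialize (Hp n); lra).
  set (s := b - a + (d - c)). assert (Hs : 0 < s) by (unfold s; lra).
  assert (Hxy : in_rect a b c d (x, y)).
  { specialize (Hx 0%nat). specialize (Hy 0%nat). destruct (Q1 0%nat) as (A1 & A2 & A3 & A4 & _).
    split; simpl in *; lra. }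
  destruct (HH (x, y) Hxy) as [D HD].
  (* With this error the integral over the [n]-th rectangle is at most
     [K / 4 ^ n / 2], half of what it must be. *)
  apply (proj1 (cderive_eps H (x, y) D)) with (eps := K / (4 * s ^ 2)) in HD.
  2: { apply Rdiv_lt_0_compat; auto. apply Rmult_lt_0_compat; try lra. apply pow_lt; auto. }
  destruct HD as [dl [Hdl HD]].
  destruct (pow_lt_1_zero (/ 2)) with (y := dl / s) as [n Hn'].
  { rewrite Rabs_pos_eq; lra. } { apply Rdiv_lt_0_compat; auto. }
  specialize (Hn' n (le_n n)). rewrite Rabs_pos_eq in Hn' by (apply pow_le; lra).
  assert (Hsn : w n + h n = s * (/ 2) ^ n).
  { unfold w, h, s. rewrite pow_inv. unfold Rdiv. ring. }
  assert (Hsn' : w n + h n < dl).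
  { rewrite Hsn. apply Rmult_lt_reg_r with (/ s). apply Rinv_0_lt_compat; auto.
    replace (s * (/ 2) ^ n * / s) with ((/ 2) ^ n) by (field; lra). exact Hn'. }
  destruct (Q1 n) as (A1 & A2 & A3 & A4 & A5).
  assert (B := boundary_integral_near_affine H (fst (q n)) (fst (q n) + w n)
    (snd (q n)) (snd (q n) + h n) (x, y) D (K / (4 * s ^ 2))).
  assert (Wn := Wp n). assert (Hnn := Hp n).
  assert (Cmod (boundary_integral H (fst (q n)) (fst (q n) + w n)
    (snd (q n)) (snd (q n) + h n)) <= 2 * (K / (4 * s ^ 2)) * (w n + h n) ^ 2).
  { replace (w n + h n) with (fst (q n) + w n - fst (q n) + (snd (q n) + h n - snd (q n))) by ring.
    apply B; try lra.
    - split; simpl; auto.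
    - apply Rlt_le, Rdiv_lt_0_compat; auto. apply Rmult_lt_0_compat; try lra. apply pow_lt; auto.
    - intros z [Z1 Z2]. apply HC. split; lra.
    - intros z [Z1 Z2]. apply HD. eapply Rle_lt_trans. apply Cmod_le_Rabs. unfold Re, Im; simpl.
      specialize (Hx n). specialize (Hy n).
      apply Rle_lt_trans with (w n + h n); auto. apply Rplus_le_compat; apply Rabs_le; lra. }
  rewrite Hsn in H0.
  assert (F : 2 * (K / (4 * s ^ 2)) * (s * (/ 2) ^ n) ^ 2 = K / 4 ^ n / 2).
  { assert (G : ((/ 2) ^ n) ^ 2 = / 4 ^ n).
    { replace (((/ 2) ^ n) ^ 2) with ((/ 2) ^ n * (/ 2) ^ n) by ring.
      rewrite <- Rpow_mult_distr, <- pow_inv. f_equal. lra. }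
    rewrite Rpow_mult_distr, G. field. split. apply Rgt_not_eq, pow_lt; lra. lra. }
  rewrite F in H0. assert (0 < K / 4 ^ n) by (apply Rdiv_lt_0_compat; auto; apply pow_lt; lra). lra.
Qed.

(** * Means over a period and over circles *)

Lemma rcont_AbsRing f t :
  rcont f t <-> continuous (T := R_UniformSpace) (U := AbsRing_UniformSpace C_AbsRing) f t.
Proof. split; intros H P HP; apply H, locally_C, HP. Qed.

Lemma rcont_const c t : rcont (fun _ => c) t.
Proof. apply continuous_const. Qed.

Lemma rcont_plus f g t : rcont f t -> rcont g t -> rcont (fun s => f s + g s)%C t.
Proof. apply (continuous_plus (V := C_R_NormedModule)). Qed.

Lemma rcont_minus f g t : rcont f t -> rcont g t -> rcont (fun s => f s - g s)%C t.
Proof. apply (continuous_minus (V := C_R_NormedModule)). Qed.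

Lemma rcont_mult f g t : rcont f t -> rcont g t -> rcont (fun s => f s * g s)%C t.
Proof. rewrite !rcont_AbsRing. apply (continuous_mult (K := C_AbsRing)). Qed.

Lemma rcont_pow f n t : rcont f t -> rcont (fun s => f s ^ n)%C t.
Proof. intros H; induction n. apply rcont_const. apply rcont_mult; auto. Qed.

Lemma rcont_pair (f g : R -> R) t : continuous f t -> continuous g t ->
  rcont (fun s => (f s, g s)) t.
Proof.
  intros Hf Hg P [d H].
  assert (A := Hf _ (locally_ball (f t) d)). assert (B := Hg _ (locally_ball (g t) d)).
  change (locally t (fun s => P (f s, g s))).
  apply (filter_imp (fun s => ball (f t) d (f s) /\ ball (g t) d (g s))).
  intros s [X Y]. apply H. split; assumption. apply filter_and; assumption.
Qed.

Lemma continuous_Re f t : rcont f t -> continuous (fun s => Re (f s)) t.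
Proof.
  intros H P [d HP]. apply (H (fun z => P (Re z))). exists d. intros z [Z1 Z2]. apply HP, Z1.
Qed.

Lemma continuous_Im f t : rcont f t -> continuous (fun s => Im (f s)) t.
Proof.
  intros H P [d HP]. apply (H (fun z => P (Im z))). exists d. intros z [Z1 Z2]. apply HP, Z2.
Qed.

Lemma rcont_conj f t : rcont f t -> rcont (fun s => Cconj (f s)) t.
Proof.
  intros H. apply (rcont_pair (fun s => Re (f s)) (fun s => - Im (f s))).
  now apply continuous_Re. apply (continuous_opp (V := R_NormedModule)). now apply continuous_Im.
Qed.

Lemma rcont_RtoC (f : R -> R) t : continuous f t -> rcont (fun s => RtoC (f s)) t.
Proof. intros H. apply (rcont_pair f (fun _ => 0)); auto. apply continuous_const. Qed.

Lemma rcont_eps f t : rcont f t -> forall eps, 0 < eps -> exists d, 0 < d /\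
  forall s, Rabs (s - t) < d -> Cmod (f s - f t) < eps.
Proof.
  intros H eps He. destruct (H (fun z => Cmod (z - f t) < eps)) as [d Hd].
  apply locally_Cmod. exists eps; auto.
  exists d; split. apply cond_pos. intros s Hs. apply Hd, Hs.
Qed.

Definition per_cont (u : R -> C) : Prop := forall t, 0 <= t <= 2 * PI -> rcont u t.
Definition mean (u : R -> C) : C := (RtoC (/ (2 * PI)) * intC u 0 (2 * PI))%C.

Lemma twoPI_pos : 0 < 2 * PI.
Proof. assert (H := PI_RGT_0). lra. Qed.

Lemma per_cont_int u : per_cont u -> is_RInt (V := CR) u 0 (2 * PI) (intC u 0 (2 * PI)).
Proof. intros H. apply RInt_correct, ex_intC; auto. apply Rlt_le, twoPI_pos. Qed.

Lemma mean_ext u v : (forall t, 0 <= t <= 2 * PI -> u t = v t) -> mean u = mean v.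
Proof.
  intros H. unfold mean. f_equal. apply (RInt_ext (V := CR)). intros t Ht. assert (P := twoPI_pos).
  rewrite Rmin_left, Rmax_right in Ht by lra. apply H; lra.
Qed.

Lemma mean_plus u v : per_cont u -> per_cont v -> mean (fun t => u t + v t)%C = (mean u + mean v)%C.
Proof.
  intros Hu Hv. unfold mean.
  replace (intC (fun t => u t + v t)%C 0 (2 * PI)) with (intC u 0 (2 * PI) + intC v 0 (2 * PI))%C.
  ring. symmetry. apply (is_RInt_unique (V := CR)). apply (is_RInt_plus (V := CR)); apply per_cont_int; auto.
Qed.

Lemma mean_minus u v : per_cont u -> per_cont v -> mean (fun t => u t - v t)%C = (mean u - mean v)%C.
Proof.
  intros Hu Hv. unfold mean.
  replace (intC (fun t => u t - v t)%C 0 (2 * PI)) with (intC u 0 (2 * PI) - intC v 0 (2 * PI))%C.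
  ring. symmetry. apply (is_RInt_unique (V := CR)). apply (is_RInt_minus (V := CR)); apply per_cont_int; auto.
Qed.

Lemma intC_pair u : per_cont u ->
  intC u 0 (2 * PI) = (RInt (fun t => Re (u t)) 0 (2 * PI), RInt (fun t => Im (u t)) 0 (2 * PI)).
Proof.
  intros H. symmetry.
  apply (RInt_fct_extend_pair (U := R_NormedModule) (V := R_NormedModule) RInt RInt).
  intros f a b l; apply (is_RInt_unique (V := R_CompleteNormedModule)).
  intros f a b l; apply (is_RInt_unique (V := R_CompleteNormedModule)).
  apply per_cont_int; auto.
Qed.

Lemma ex_RInt_2PI (f : R -> R) : (forall t, 0 <= t <= 2 * PI -> continuous f t) -> ex_RInt f 0 (2 * PI).
Proof.
  intros H. assert (P := twoPI_pos). apply (ex_RInt_continuous (V := R_CompleteNormedModule)).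
  intros t Ht. rewrite Rmin_left, Rmax_right in Ht by lra. apply H; lra.
Qed.

(** The integral is linear over the reals only, so that a complex factor is
    moved out through real and imaginary parts. *)
Lemma mean_scal c u : per_cont u -> mean (fun t => c * u t)%C = (c * mean u)%C.
Proof.
  intros H. unfold mean.
  assert (per_cont (fun t => c * u t)%C). { intros t Ht. apply rcont_mult; auto. apply rcont_const. }
  rewrite !intC_pair; auto.
  assert (E1 := ex_RInt_2PI _ (fun t Ht => continuous_Re _ _ (H t Ht))).
  assert (E2 := ex_RInt_2PI _ (fun t Ht => continuous_Im _ _ (H t Ht))).
  set (I1 := RInt (fun t => Re (u t)) 0 (2 * PI)). set (I2 := RInt (fun t => Im (u t)) 0 (2 * PI)).
  replace (RInt (fun t => Re (c * u t)) 0 (2 * PI)) with (Re c * I1 - Im c * I2).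
  replace (RInt (fun t => Im (c * u t)) 0 (2 * PI)) with (Im c * I1 + Re c * I2).
  - apply injective_projections; unfold Re, Im; simpl; ring.
  - symmetry. apply (is_RInt_unique (V := R_CompleteNormedModule)).
    apply (is_RInt_ext (fun t => Im c * Re (u t) + Re c * Im (u t))). intros; unfold Re, Im; simpl; ring.
    apply (is_RInt_plus (V := R_NormedModule)); apply (is_RInt_scal (V := R_NormedModule));
    now apply (RInt_correct (V := R_CompleteNormedModule)).
  - symmetry. apply (is_RInt_unique (V := R_CompleteNormedModule)).
    apply (is_RInt_ext (fun t => Re c * Re (u t) - Im c * Im (u t))). intros; unfold Re, Im; simpl; ring.
    apply (is_RInt_minus (V := R_NormedModule)); apply (is_RInt_scal (V := R_NormedModule));
    now apply (RInt_correct (V := R_CompleteNormedModule)).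
Qed.

Lemma mean_conj u : per_cont u -> mean (fun t => Cconj (u t)) = Cconj (mean u).
Proof.
  intros H. unfold mean.
  assert (per_cont (fun t => Cconj (u t))). { intros t Ht. apply rcont_conj; auto. }
  rewrite !intC_pair; auto.
  assert (E2 := ex_RInt_2PI _ (fun t Ht => continuous_Im _ _ (H t Ht))).
  replace (RInt (fun t => Im (Cconj (u t))) 0 (2 * PI)) with (- RInt (fun t => Im (u t)) 0 (2 * PI)).
  - apply injective_projections; unfold Re, Im; simpl; ring.
  - symmetry. apply (RInt_opp (V := R_CompleteNormedModule)); auto.
Qed.

Lemma mean_const c : mean (fun _ => c) = c.
Proof.
  unfold mean, intC. rewrite (RInt_const (V := CR)).
  change (scal (2 * PI - 0) c) with (scal (V := C_R_ModuleSpace) (2 * PI - 0) c). rewrite scal_R_Cmult.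
  rewrite Cmult_assoc, <- RtoC_mult. assert (P := twoPI_pos).
  replace (/ (2 * PI) * (2 * PI - 0)) with 1 by (field; lra). ring.
Qed.

Lemma mean_le u (g : R -> R) : per_cont u -> (forall t, 0 <= t <= 2 * PI -> continuous g t) ->
  (forall t, 0 <= t <= 2 * PI -> Cmod (u t) <= g t) ->
  Cmod (mean u) <= Re (mean (fun t => RtoC (g t))).
Proof.
  intros Hu Hg H. unfold mean. assert (P := twoPI_pos).
  assert (Pi : 0 < / (2 * PI)) by (apply Rinv_0_lt_compat; auto).
  rewrite re_scal_l, Cmod_mult, Cmod_R, Rabs_pos_eq by lra.
  apply Rmult_le_compat_l. lra.
  rewrite (intC_pair (fun t => RtoC (g t))). 2: intros t Ht; apply rcont_RtoC; auto.
  rewrite <- norm_CR_Cmod.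
  apply (norm_RInt_le (V := C_R_NormedModule) u g 0 (2 * PI)). lra.
  intros t Ht. rewrite norm_CR_Cmod. auto. apply per_cont_int; auto.
  change (is_RInt g 0 (2 * PI) (RInt g 0 (2 * PI))).
  apply (RInt_correct (V := R_CompleteNormedModule)), ex_RInt_2PI; auto.
Qed.

Lemma mean_bound u M : per_cont u -> (forall t, 0 <= t <= 2 * PI -> Cmod (u t) <= M) ->
  Cmod (mean u) <= M.
Proof.
  intros Hu HM. replace M with (Re (mean (fun _ => RtoC M))).
  apply (mean_le u (fun _ => M)); auto. intros; apply continuous_const. now rewrite mean_const.
Qed.

Definition cis (t : R) : C := (cos t, sin t).

Lemma Cmod_cis t : Cmod (cis t) = 1.
Proof.
  unfold Cmod, cis. rewrite <- sqrt_1. f_equal. assert (H := sin2_cos2 t). unfold Rsqr in H. simpl. lra.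
Qed.

Lemma Cmod_circle r t : 0 <= r -> Cmod (r * cis t) = r.
Proof. intros H. now rewrite Cmod_mult, Cmod_R, Cmod_cis, Rmult_1_r, Rabs_pos_eq. Qed.

Lemma rcont_circle r t : rcont (fun s => r * cis s)%C t.
Proof.
  apply rcont_mult. apply rcont_const. apply rcont_pair.
  apply continuous_cos. apply continuous_sin.
Qed.

Lemma circle_Cexp r t : 0 < r -> Cexp (ln r, t) = (r * cis t)%C.
Proof. intros H. unfold Cexp; simpl. rewrite exp_ln by auto. apply injective_projections; simpl; ring. Qed.

Definition circle_mean (G : C -> C) (r : R) : C := mean (fun t => G (r * cis t)%C).

Lemma per_cont_circle G r : 0 <= r -> (forall z, Cmod z = r -> ccont G z) ->
  per_cont (fun t => G (r * cis t)%C).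
Proof.
  intros Hr H t _. apply (rcont_comp G). apply rcont_circle. apply H. now apply Cmod_circle.
Qed.

Lemma exp_mono x y : x <= y -> exp x <= exp y.
Proof. intros [H | ->]; [left; now apply exp_increasing | lra]. Qed.

(** In the coordinate [log w] the annulus becomes a rectangle of height [2 PI].
    The integrals over its horizontal sides cancel by periodicity, and the
    vertical sides are the two circles. *)
Lemma circle_mean_annulus G r1 r2 : 0 < r1 -> r1 < r2 ->
  (forall z, r1 <= Cmod z <= r2 -> cdiff G z) -> circle_mean G r1 = circle_mean G r2.
Proof.
  intros H1 H2 HG. assert (P := twoPI_pos).
  assert (L : ln r1 < ln r2) by (apply ln_increasing; auto).
  assert (B := goursat_rect (fun z => G (Cexp z)) (ln r1) (ln r2) 0 (2 * PI) L P).
  unfold boundary_integral in B.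
  replace (intC (fun t => G (Cexp (t, 2 * PI))) (ln r1) (ln r2))
    with (intC (fun t => G (Cexp (t, 0))) (ln r1) (ln r2)) in B.
  2: { apply (RInt_ext (V := CR)). intros t _. f_equal. unfold Cexp, Re, Im; simpl.
       now rewrite cos_2PI, sin_2PI, cos_0, sin_0. }
  assert (E : forall r, 0 < r -> intC (fun t => G (Cexp (ln r, t))) 0 (2 * PI) =
    intC (fun t => G (r * cis t)%C) 0 (2 * PI)).
  { intros r Hr. apply (RInt_ext (V := CR)). intros t _. now rewrite circle_Cexp. }
  rewrite !E in B by lra.
  unfold circle_mean, mean. f_equal. symmetry.
  apply Ceq_minus. set (X := intC (fun t => G (r2 * cis t)%C) _ _) in *.
  set (Y := intC (fun t => G (r1 * cis t)%C) _ _) in *.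
  replace (X - Y)%C with (- Ci * (Ci * (X - Y)))%C.
  2: { apply injective_projections; simpl; ring. }
  match type of B with _ -> (?p - ?p + ?q)%C = _ => replace (p - p + q)%C with q in B by ring end.
  rewrite B. ring.
  intros [x y] [Z1 Z2]. simpl in *.
  destruct (HG (Cexp (x, y))) as [l Hl].
  { rewrite Cmod_Cexp. simpl. split.
    - rewrite <- (exp_ln r1) by lra. apply exp_mono. lra.
    - rewrite <- (exp_ln r2) by lra. apply exp_mono. lra. }
  eexists. apply (cderive_comp G Cexp). exact Hl. apply cderive_Cexp.
Qed.

(** The circle is compact, so that [G] is uniformly close on neighbouring
    circles. *)
Lemma circle_mean_continuous G rho r0 : 0 <= r0 < rho -> (forall z, Cmod z < rho -> ccont G z) ->
  forall eps, 0 < eps -> exists d, 0 < d /\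
    forall r, 0 <= r < rho -> Rabs (r - r0) < d -> Cmod (circle_mean G r - circle_mean G r0) <= eps.
Proof.
  intros Hr0 HG eps He.
  assert (Hd : forall t0, exists d : posreal, forall r t, Rabs (r - r0) < d -> Rabs (t - t0) < d ->
     Cmod (G (r * cis t)%C - G (r0 * cis t0)%C) < eps / 2).
  { intros t0. assert (Hz : ccont G (r0 * cis t0)%C). { apply HG. rewrite Cmod_circle; lra. }
    rewrite continuous_Cmod in Hz. destruct (Hz (eps / 2)) as [e [E1 E2]]; [lra|].
    destruct (rcont_eps _ _ (rcont_circle r0 t0) (e / 2)) as [d [D1 D2]]; [lra|].
    assert (Hm : 0 < Rmin d (e / 2)) by (apply Rmin_pos; lra).
    exists (mkposreal _ Hm). simpl. intros r t X Y. apply E2.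
    replace (r * cis t - r0 * cis t0)%C with ((r - r0)%R * cis t + (r0 * cis t - r0 * cis t0))%C
      by (rewrite RtoC_minus; ring).
    eapply Rle_lt_trans. apply Cmod_triangle. rewrite Cmod_mult, Cmod_R, Cmod_cis.
    assert (Y' := D2 t (Rlt_le_trans _ _ _ Y (Rmin_l _ _))).
    assert (X' := Rlt_le_trans _ _ _ X (Rmin_r _ _)). lra. }
  set (delta := fun t => proj1_sig (constructive_indefinite_description _ (Hd t))).
  assert (Hdelta : forall t0 r t, Rabs (r - r0) < delta t0 -> Rabs (t - t0) < delta t0 ->
     Cmod (G (r * cis t)%C - G (r0 * cis t0)%C) < eps / 2).
  { intros t0. unfold delta. destruct (constructive_indefinite_description _ _); auto. }
  destruct (compactness_value_1d 0 (2 * PI) delta) as [d D].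
  exists d; split. apply cond_pos. intros r Hr Hrd.
  assert (Pc : forall s, 0 <= s < rho -> per_cont (fun t => G (s * cis t)%C)).
  { intros s Hs. apply per_cont_circle. lra. intros z Hz. apply HG. lra. }
  unfold circle_mean. rewrite <- mean_minus by (apply Pc; lra).
  apply mean_bound. { intros t Ht. apply rcont_minus; apply Pc; auto. }
  intros t Ht. apply Rnot_lt_le. intros Hlt. apply (D t Ht). intros [t0 [_ [T1 T2]]].
  assert (A := Hdelta t0 r t ltac:(lra) T1). assert (B := Hdelta t0 r0 t).
  rewrite Rminus_diag, Rabs_R0 in B. specialize (B (cond_pos _) T1).
  assert (Cmod (G (r * cis t)%C - G (r0 * cis t)%C) <=
    Cmod (G (r * cis t)%C - G (r0 * cis t0)%C) + Cmod (G (r0 * cis t)%C - G (r0 * cis t0)%C)).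
  { rewrite <- (Cmod_opp (G (r0 * cis t)%C - _)%C).
    eapply Rle_trans. 2: apply Cmod_triangle. right. f_equal. ring. }
  lra.
Qed.

Lemma Cmod_le_eps_eq (a b : C) : (forall eps, 0 < eps -> Cmod (a - b) <= eps) -> a = b.
Proof.
  intros H. apply Ceq_minus, Cmod_eq_0. assert (P := Cmod_ge_0 (a - b)).
  destruct P as [P|P]; auto. specialize (H (Cmod (a - b) / 2) ltac:(lra)). lra.
Qed.

(** One point [z0] where [G] is merely continuous is admitted, because the
    Cauchy formula applies this to a difference quotient. The mean is constant
    on either side of the circle through [z0], and its continuity in the radius
    bridges that circle and the centre. *)
Theorem mean_value G rho z0 :
  (forall z, Cmod z < rho -> ccont G z) ->
  (forall z, Cmod z < rho -> z <> z0 -> cdiff G z) ->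
  forall r, 0 <= r < rho -> circle_mean G r = G 0.
Proof.
  intros HG HD.
  assert (Hann : forall r1 r2, 0 < r1 -> r1 < r2 -> r2 < rho -> ~ (r1 <= Cmod z0 <= r2) ->
    circle_mean G r1 = circle_mean G r2).
  { intros r1 r2 A B D E. apply circle_mean_annulus; auto. intros z Hz. apply HD. lra. intros ->. auto. }
  assert (M0 : circle_mean G 0 = G 0).
  { unfold circle_mean. rewrite (mean_ext _ (fun _ => G 0)). apply mean_const. intros t _. f_equal. ring. }
  set (s := Cmod z0) in *. assert (Hs : 0 <= s) by apply Cmod_ge_0.
  assert (C1 : forall r, 0 <= r < rho -> r < s -> circle_mean G r = G 0).
  { intros r Hr Hrs. destruct (Req_dec r 0) as [->|Hn]; auto.
    apply Cmod_le_eps_eq. intros eps He. rewrite <- M0.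
    destruct (circle_mean_continuous G rho 0 ltac:(lra) HG eps He) as [d [D1 D2]].
    assert (0 < Rmin (d / 2) (r / 2)) by (apply Rmin_pos; lra).
    assert (A1 := Rmin_l (d / 2) (r / 2)). assert (A2 := Rmin_r (d / 2) (r / 2)).
    rewrite <- (Hann (Rmin (d / 2) (r / 2)) r); try lra.
    apply D2. lra. rewrite Rminus_0_r, Rabs_pos_eq; lra. }
  assert (C2 : s < rho -> circle_mean G s = G 0).
  { intros Hsr. destruct (Req_dec s 0) as [E|Hn]; [rewrite E; auto|].
    apply Cmod_le_eps_eq. intros eps He.
    destruct (circle_mean_continuous G rho s ltac:(lra) HG eps He) as [d [D1 D2]].
    assert (0 < Rmin (d / 2) (s / 2)) by (apply Rmin_pos; lra).
    assert (A1 := Rmin_l (d / 2) (s / 2)). assert (A2 := Rmin_r (d / 2) (s / 2)).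
    rewrite <- (C1 (s - Rmin (d / 2) (s / 2))) by lra.
    rewrite <- Cmod_opp, Copp_minus_distr.
    apply D2. lra. rewrite Rabs_minus_sym, Rabs_pos_eq; lra. }
  intros r Hr. destruct (Rlt_le_dec r s) as [Hl|Hl]; auto.
  destruct Hl as [Hl|Hl]. 2: { rewrite <- Hl. apply C2; lra. }
  apply Cmod_le_eps_eq. intros eps He. rewrite <- C2 by lra.
  destruct (circle_mean_continuous G rho s ltac:(lra) HG eps He) as [d [D1 D2]].
  assert (0 < Rmin (d / 2) ((r - s) / 2)) by (apply Rmin_pos; lra).
  assert (A1 := Rmin_l (d / 2) ((r - s) / 2)). assert (A2 := Rmin_r (d / 2) ((r - s) / 2)).
  rewrite <- (Hann (s + Rmin (d / 2) ((r - s) / 2)) r); try lra.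
  apply D2. lra. rewrite Rabs_pos_eq; lra.
Qed.

Lemma ccont_AbsRing f z :
  ccont f z <-> continuous (T := C_UniformSpace) (U := AbsRing_UniformSpace C_AbsRing) f z.
Proof. split; intros H P HP; apply H, locally_C, HP. Qed.

Lemma ccont_mult f g z : ccont f z -> ccont g z -> ccont (fun w => f w * g w)%C z.
Proof. rewrite !ccont_AbsRing. apply (continuous_mult (K := C_AbsRing)). Qed.

Lemma rcont_inv f t : rcont f t -> f t <> 0 -> rcont (fun s => / f s)%C t.
Proof.
  intros H H0. apply (rcont_comp Cinv f); auto. eapply cderive_continuous. now apply cderive_Cinv.
Qed.

(** * The Cauchy formula and Taylor expansion *)

Definition cseries (u : nat -> C) (l : C) : Prop := is_series (K := C_AbsRing) (V := C_NormedModule) u l.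
Definition csum (u : nat -> C) (n : nat) : C := sum_n (G := C_AbelianGroup) u n.

Lemma csum_S u n : csum u (S n) = (csum u n + u (S n))%C.
Proof. apply (sum_Sn (G := C_AbelianGroup)). Qed.

Lemma csum_0 u : csum u 0 = u 0%nat.
Proof. apply (sum_O (G := C_AbelianGroup)). Qed.

Lemma cseries_eps u l : cseries u l <->
  forall eps, 0 < eps -> exists N, forall n, (N <= n)%nat -> Cmod (csum u n - l) < eps.
Proof.
  split.
  - intros H eps He. apply (H (fun z => Cmod (z - l) < eps)).
    apply locally_Cmod. exists eps; auto.
  - intros H P HP. apply locally_Cmod in HP. destruct HP as [e [He HP]].
    destruct (H e He) as [N HN]. exists N. intros n Hn. apply HP, HN, Hn.
Qed.

Lemma cseries_ext u v l : (forall n, u n = v n) -> cseries u l -> cseries v l.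
Proof. apply (is_series_ext (K := C_AbsRing) (V := C_NormedModule)). Qed.

Lemma cseries_plus u v l m : cseries u l -> cseries v m ->
  cseries (fun n => u n + v n)%C (l + m).
Proof. apply (is_series_plus (K := C_AbsRing) (V := C_NormedModule)). Qed.

Lemma cseries_minus u v l m : cseries u l -> cseries v m ->
  cseries (fun n => u n - v n)%C (l - m).
Proof. apply (is_series_minus (K := C_AbsRing) (V := C_NormedModule)). Qed.

Lemma cseries_scal c u l : cseries u l -> cseries (fun n => c * u n)%C (c * l).
Proof. apply (is_series_scal (K := C_AbsRing) (V := C_NormedModule)). Qed.

Lemma cseries_shift u l : cseries (fun n => u (S n)) l -> cseries u (u 0%nat + l).
Proof.
  intros H. apply (is_series_decr_1 (K := C_AbsRing) (V := C_NormedModule)).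
  change (cseries (fun n => u (S n)) (u 0%nat + l + - u 0%nat)%C).
  replace (u 0%nat + l + - u 0%nat)%C with l by ring. exact H.
Qed.

Lemma pow_n_Cpow (z : C) n : pow_n (K := C_Ring) z n = (z ^ n)%C.
Proof. induction n; simpl. reflexivity. now rewrite IHn. Qed.

Definition cps (a : nat -> C) (z l : C) : Prop :=
  is_pseries (K := C_AbsRing) (V := C_NormedModule) a z l.

Lemma cps_series a z l : cps a z l <-> cseries (fun n => z ^ n * a n)%C l.
Proof.
  split; apply (is_series_ext (K := C_AbsRing) (V := C_NormedModule)); intros n.
  - now rewrite <- pow_n_Cpow.
  - now rewrite <- pow_n_Cpow.
Qed.

Lemma geometric_bound q M eps : 0 <= q < 1 -> 0 < eps ->
  exists N, forall n, (N <= n)%nat -> q ^ n * M < eps.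
Proof.
  intros Hq He. destruct (pow_lt_1_zero q) with (y := eps / (Rabs M + 1)) as [N HN].
  rewrite Rabs_pos_eq; lra. apply Rdiv_lt_0_compat; auto. assert (H := Rabs_pos M). lra.
  exists N. intros n Hn. specialize (HN n Hn). assert (H := Rabs_pos M).
  assert (Hp : 0 <= q ^ n) by (apply pow_le; lra). rewrite Rabs_pos_eq in HN by auto.
  assert (H1 := Rle_abs M).
  apply Rle_lt_trans with (q ^ n * (Rabs M + 1)). apply Rmult_le_compat_l; lra.
  apply Rmult_lt_compat_r with (r := Rabs M + 1) in HN; [|lra].
  replace (eps / (Rabs M + 1) * (Rabs M + 1)) with eps in HN by (field; lra). exact HN.
Qed.

Lemma per_cont_bounded u : per_cont u -> exists M, 0 <= M /\ forall t, 0 <= t <= 2 * PI -> Cmod (u t) <= M.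
Proof.
  intros Hu. destruct (bounded_continuity (V := C_R_NormedModule) u 0 (2 * PI) Hu) as [M HM].
  exists (Rabs M). split. apply Rabs_pos. intros t Ht. specialize (HM t Ht). rewrite norm_CR_Cmod in HM.
  assert (H := Rle_abs M). lra.
Qed.

Lemma Cmod_minus_lower w z : Cmod w - Cmod z <= Cmod (w - z).
Proof.
  assert (H := Cmod_triangle (w - z) z). replace (w - z + z)%C with w in H by ring. lra.
Qed.

(** The geometric expansion of [w / (w - z)] in powers of [z / w]. The weighted
    means [K n] of its remainders telescope, which identifies the partial sums
    without any interchange of sum and integral. *)
Lemma cauchy_kernel_series u z r : per_cont u -> Cmod z < r ->
  cseries (fun n => z ^ n * mean (fun t => u t * (/ (r * cis t)) ^ n))%C
    (mean (fun t => u t * (r * cis t / (r * cis t - z)))%C).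
Proof.
  intros Hu Hz. assert (Hz0 := Cmod_ge_0 z). assert (Hr : 0 < r) by lra.
  set (w := fun t => (r * cis t)%C).
  assert (Wm : forall t, Cmod (w t) = r) by (intros; apply Cmod_circle; lra).
  assert (Wz : forall t, r - Cmod z <= Cmod (w t - z)%C) by (intros; rewrite <- (Wm t); apply Cmod_minus_lower).
  assert (W0 : forall t, w t <> 0) by (intros t; apply Cmod_gt_0; rewrite Wm; lra).
  assert (Wz0 : forall t, (w t - z)%C <> 0) by (intros t; apply Cmod_gt_0; specialize (Wz t); lra).
  assert (Wc : forall t, rcont w t) by (intros; apply rcont_circle).
  assert (Wic : forall t, rcont (fun t => / w t)%C t) by (intros; apply rcont_inv; auto).
  assert (Kc : forall t, rcont (fun t => w t / (w t - z))%C t).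
  { intros t. apply rcont_mult; auto. apply rcont_inv; auto. apply rcont_minus; auto. apply rcont_const. }
  set (K := fun n => mean (fun t => u t * ((z * / w t) ^ n * (w t / (w t - z))))%C).
  assert (Kp : forall n, per_cont (fun t => u t * ((z * / w t) ^ n * (w t / (w t - z))))%C).
  { intros n t Ht. apply rcont_mult; auto. apply rcont_mult; auto.
    apply rcont_pow, rcont_mult; auto. apply rcont_const. }
  assert (Ap : forall n, per_cont (fun t => u t * (/ w t) ^ n)%C).
  { intros n t Ht. apply rcont_mult; auto. now apply rcont_pow. }
  assert (KS : forall n, (z ^ n * mean (fun t => u t * (/ w t) ^ n) = K n - K (S n))%C).
  { intros n. unfold K. rewrite <- mean_minus, <- mean_scal; auto. apply mean_ext. intros t _.
    rewrite Cpow_mult_l, Cpow_S. rewrite Cpow_mult_l. field. auto. }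
  assert (Sum : forall n, csum (fun n => z ^ n * mean (fun t => u t * (/ w t) ^ n))%C n = (K 0%nat - K (S n))%C).
  { induction n. rewrite csum_0. apply KS. rewrite csum_S, IHn, KS. ring. }
  assert (K0 : K 0%nat = mean (fun t => u t * (r * cis t / (r * cis t - z)))%C).
  { apply mean_ext. intros t _. unfold w; simpl. ring. }
  rewrite <- K0. apply cseries_eps. intros eps He.
  destruct (per_cont_bounded u Hu) as [M [HM0 HM]].
  destruct (geometric_bound (Cmod z / r) (Cmod z / r * (M * (r / (r - Cmod z)))) eps) as [N HN]; auto.
  { split. apply Rmult_le_pos; auto. left; now apply Rinv_0_lt_compat.
    apply Rmult_lt_reg_r with r; auto. unfold Rdiv. rewrite Rmult_assoc, Rinv_l; lra. }
  exists N. intros n Hn. fold w. rewrite Sum.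
  replace (K 0%nat - K (S n) - K 0%nat)%C with (- K (S n))%C by ring. rewrite Cmod_opp.
  eapply Rle_lt_trans; [|apply (HN n Hn)].
  apply mean_bound; auto. intros t Ht.
  unfold Cdiv. rewrite !Cmod_mult, Cmod_pow, Cmod_mult, !Cmod_inv, !Wm by auto.
  replace ((Cmod z / r) ^ n * (Cmod z / r * (M * (r / (r - Cmod z)))))
    with (M * ((Cmod z * / r) ^ S n * (r * / (r - Cmod z)))) by (simpl; unfold Rdiv; ring).
  assert (0 <= Cmod z * / r). { apply Rmult_le_pos; auto. left; now apply Rinv_0_lt_compat. }
  assert (0 < / Cmod (w t - z)%C). { apply Rinv_0_lt_compat. specialize (Wz t); lra. }
  apply Rmult_le_compat; auto. apply Cmod_ge_0.
  apply Rmult_le_pos. now apply pow_le. apply Rmult_le_pos; lra.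
  apply Rmult_le_compat_l. now apply pow_le.
  apply Rmult_le_compat_l. lra. apply Rinv_le_contravar. lra. auto.
Qed.

Lemma cdiff_kernel z w : (w - z)%C <> 0 -> cdiff (fun w => w / (w - z))%C w.
Proof.
  intros H. apply cdiff_div; [| |exact H]. apply cdiff_id.
  apply cdiff_minus. apply cdiff_id. apply cdiff_const.
Qed.

(** The mean does not depend on the radius, and the kernel tends to 1 when the
    radius goes to infinity. *)
Lemma circle_mean_kernel z r : Cmod z < r -> circle_mean (fun w => w / (w - z))%C r = 1.
Proof.
  intros Hz. assert (Hz0 := Cmod_ge_0 z). apply Cmod_le_eps_eq. intros eps He.
  (* Large enough for [|z| / (r2 - |z|) <= eps]. *)
  set (r2 := r + Cmod z + Cmod z / eps + 1).
  assert (Hq : 0 <= Cmod z / eps) by (apply Rmult_le_pos; auto; left; now apply Rinv_0_lt_compat).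
  assert (D : forall w, r <= Cmod w -> (w - z)%C <> 0).
  { intros w Hw. apply Cmod_gt_0. assert (H := Cmod_minus_lower w z). lra. }
  rewrite (circle_mean_annulus _ r r2); [|lra|unfold r2; lra|].
  2: { intros w Hw. apply cdiff_kernel, D. lra. }
  assert (C0 : per_cont (fun t => r2 * cis t / (r2 * cis t - z))%C).
  { apply (per_cont_circle (fun w => w / (w - z))%C). unfold r2; lra.
    intros w Hw. apply cdiff_ccont, cdiff_kernel, D. unfold r2 in Hw. lra. }
  rewrite <- (mean_const 1). unfold circle_mean. rewrite <- mean_minus; auto.
  2: { intros t _. apply rcont_const. }
  apply mean_bound. { intros t Ht. apply rcont_minus; auto. apply rcont_const. }
  intros t _. assert (Wm : Cmod (r2 * cis t) = r2) by (apply Cmod_circle; unfold r2; lra).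
  set (w := (r2 * cis t)%C) in *.
  assert (Dw : (w - z)%C <> 0) by (apply D; rewrite Wm; unfold r2; lra).
  replace (w / (w - z) - 1)%C with (z / (w - z))%C by (field; auto).
  rewrite Cmod_div by auto.
  assert (L := Cmod_minus_lower w z). rewrite Wm in L.
  assert (0 < Cmod (w - z)) by (apply Cmod_gt_0; auto).
  apply Rmult_le_reg_r with (Cmod (w - z)); auto. unfold Rdiv. rewrite Rmult_assoc, Rinv_l by lra.
  apply Rle_trans with (eps * (Cmod z / eps)). right; field; lra.
  apply Rmult_le_compat_l. lra. unfold r2 in L. lra.
Qed.

(** The mean value property of [w * (f w - f z) / (w - z)], which is continuous
    at [z] and vanishes at 0. *)
Theorem cauchy_formula f rho z r : (forall w, Cmod w < rho -> cdiff f w) ->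
  Cmod z < r < rho -> circle_mean (fun w => f w * (w / (w - z)))%C r = f z.
Proof.
  intros Hf Hr. assert (Hz0 := Cmod_ge_0 z).
  destruct (Hf z) as [l Hl]; [lra|].
  assert (Fc : forall w, Cmod w < rho -> ccont f w) by (intros; now apply cdiff_ccont, Hf).
  set (G := fun w => (w * (if Ceq_dec w z then l else (f w - f z) / (w - z)))%C).
  assert (G0 : G 0 = 0) by (unfold G; ring).
  assert (Gd : forall w, Cmod w < rho -> w <> z -> cdiff G w).
  { intros w Hw Hwz.
    assert (Hwz' : (w - z)%C <> 0) by now apply Cminus_eq_contra.
    assert (E : cdiff (fun w => w * ((f w - f z) / (w - z)))%C w).
    { apply cdiff_mult. apply cdiff_id. apply cdiff_div; [| |exact Hwz'].
      apply cdiff_minus. now apply Hf. apply cdiff_const.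
      apply cdiff_minus. apply cdiff_id. apply cdiff_const. }
    destruct E as [e E]. exists e. revert E. apply cderive_ext_loc.
    exists (Cmod (w - z)). split. now apply Cmod_gt_0. intros v Hv. unfold G.
    destruct (Ceq_dec v z) as [->|]; auto. exfalso.
    rewrite <- Cmod_opp, Copp_minus_distr in Hv. lra. }
  assert (Gc : forall w, Cmod w < rho -> ccont G w).
  { intros w Hw. destruct (Ceq_dec w z) as [->|Hwz]. 2: now apply cdiff_ccont, Gd.
    assert (Q : ccont (fun w => if Ceq_dec w z then l else ((f w - f z) / (w - z))%C) z).
    { apply continuous_Cmod. intros eps He. destruct (proj1 (cderive_eps f z l) Hl (eps / 2)) as [d [D1 D2]]; [lra|].
      exists d; split; auto. intros v Hv. destruct (Ceq_dec z z) as [_|]; [|congruence].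
      destruct (Ceq_dec v z) as [->|Hvz]. replace (l - l)%C with (RtoC 0) by ring. now rewrite Cmod_0.
      assert (Hvz' : (v - z)%C <> 0) by now apply Cminus_eq_contra.
      replace ((f v - f z) / (v - z) - l)%C with ((f v - f z - l * (v - z)) / (v - z))%C by (field; auto).
      rewrite Cmod_div by auto. assert (0 < Cmod (v - z)) by now apply Cmod_gt_0.
      apply Rle_lt_trans with (eps / 2); [|lra].
      apply Rmult_le_reg_r with (Cmod (v - z)); auto. unfold Rdiv at 1. rewrite Rmult_assoc, Rinv_l by lra.
      rewrite Rmult_1_r. apply D2; auto. }
    apply (ccont_mult (fun w => w)); auto. apply continuous_id. }
  assert (M := mean_value G rho z Gc Gd r ltac:(lra)). rewrite G0 in M.
  assert (Wz : forall t, (r * cis t)%C <> z).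
  { intros t E. assert (Cmod (r * cis t) = r) by (apply Cmod_circle; lra). rewrite E in H. lra. }
  assert (Ckc : forall w, Cmod w = r -> ccont (fun w => w / (w - z))%C w).
  { intros w Hw. apply cdiff_ccont, cdiff_kernel, Cminus_eq_contra. intros ->. lra. }
  assert (P1 : per_cont (fun t => r * cis t / (r * cis t - z))%C).
  { apply (per_cont_circle (fun w => w / (w - z))%C); auto. lra. }
  assert (P2 : per_cont (fun t => f (r * cis t) * (r * cis t / (r * cis t - z)))%C).
  { intros t Ht. apply rcont_mult. apply (per_cont_circle f); auto. lra. intros; apply Fc; lra. now apply P1. }
  assert (E : circle_mean G r =
    (circle_mean (fun w => f w * (w / (w - z))) r - f z * circle_mean (fun w => w / (w - z)) r)%C).
  { unfold circle_mean. rewrite <- mean_scal, <- mean_minus; auto.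
    2: { intros t Ht. apply rcont_mult. apply rcont_const. now apply P1. }
    apply mean_ext. intros t _. unfold G. destruct (Ceq_dec _ z) as [E|_]. now apply Wz in E.
    field. apply Cminus_eq_contra; auto. }
  rewrite E, circle_mean_kernel in M by lra. apply Ceq_minus. rewrite <- M. ring.
Qed.

Definition has_ps (f : C -> C) (a : nat -> C) (rho : R) : Prop :=
  forall z, Cmod z < rho -> cps a z (f z).

(** The Cauchy formula on a circle between [|z|] and [rho], with its kernel
    expanded. The coefficients are means over circles in the punctured disc, so
    they do not depend on the radius; their integral form is kept because it
    gives the moments of [Re p] on circles. *)
Theorem taylor f rho : 0 < rho -> (forall w, Cmod w < rho -> cdiff f w) ->
  exists a, has_ps f a rho /\
    forall r n, 0 < r < rho -> circle_mean (fun w => f w * (/ w) ^ n)%C r = a n.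
Proof.
  intros Hrho Hf.
  set (a := fun n => circle_mean (fun w => f w * (/ w) ^ n)%C (rho / 2)). exists a.
  assert (Ha : forall r n, 0 < r < rho -> circle_mean (fun w => f w * (/ w) ^ n)%C r = a n).
  { intros r n Hr.
    assert (D : forall w, 0 < Cmod w < rho -> cdiff (fun w => f w * (/ w) ^ n)%C w).
    { intros w Hw. apply cdiff_mult. apply Hf; lra. apply cdiff_pow.
      eexists. apply cderive_Cinv, Cmod_gt_0. lra. }
    unfold a. destruct (Rtotal_order r (rho / 2)) as [H|[->|H]]; auto.
    - apply circle_mean_annulus; try lra. intros; apply D; lra.
    - symmetry. apply circle_mean_annulus; try lra. intros; apply D; lra. }
  split; auto. intros z Hz. assert (Hz0 := Cmod_ge_0 z).
  set (r := (Cmod z + rho) / 2).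
  rewrite <- (cauchy_formula f rho z r); auto. 2: unfold r; lra.
  apply cps_series.
  apply (cseries_ext (fun n => z ^ n * mean (fun t => f (r * cis t) * (/ (r * cis t)) ^ n))%C).
  { intros n. rewrite <- (Ha r n). reflexivity. unfold r; lra. }
  apply (cauchy_kernel_series (fun t => f (r * cis t)%C)). 2: unfold r; lra.
  apply per_cont_circle. unfold r; lra. intros w Hw. apply cdiff_ccont, Hf. unfold r in Hw; lra.
Qed.

(** * Termwise differentiation and uniqueness of coefficients *)

Lemma cps_coef_bound a r l : 0 <= r -> cps a (RtoC r) l ->
  exists K, 0 <= K /\ forall n, Cmod (a n) * r ^ n <= K.
Proof.
  intros Hr H. rewrite cps_series in H.
  destruct (filterlim_bounded (K := C_AbsRing) (V := C_NormedModule) _ (ex_intro _ l H)) as [M HM].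
  change (forall n, Cmod (csum (fun n => r ^ n * a n)%C n) <= M) in HM.
  assert (E : forall n, Cmod (a n) * r ^ n = Cmod (r ^ n * a n)%C).
  { intros n. rewrite Cmod_mult, Cmod_pow, Cmod_R, Rabs_pos_eq by auto. ring. }
  assert (M0 : 0 <= M) by (eapply Rle_trans; [apply Cmod_ge_0 | apply (HM 0%nat)]).
  exists (2 * M). split. lra. intros n. rewrite E. destruct n.
  - specialize (HM 0%nat). rewrite csum_0 in HM. lra.
  - assert (A := HM (S n)). assert (B := HM n). rewrite csum_S in A.
    set (u := (r ^ S n * a (S n))%C) in *. set (s := csum _ n) in *.
    assert (T := Cmod_minus_lower u (- s)). rewrite Cmod_opp in T.
    replace (u - - s)%C with (s + u)%C in T by ring. lra.
Qed.

(** These are the coefficients of the second derivative of the geometric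
    series, the majorant for all series of this part. *)
Lemma ex_series_second q : 0 <= q < 1 -> ex_series (fun n => INR (S n) * INR (S (S n)) * q ^ n).
Proof.
  intros Hq. set (c := fun _ : nat => 1).
  assert (H1 : Rbar_le 1 (CV_radius c)).
  { assert (H := CV_radius_bounded c). apply H. exists 1. intros n. unfold c.
    rewrite pow1, Rmult_1_r, Rabs_R1. lra. }
  assert (H2 : Rbar_lt (Rabs q) (CV_radius (PS_derive (PS_derive c)))).
  { rewrite !CV_radius_derive. eapply Rbar_lt_le_trans; [|exact H1]. simpl. rewrite Rabs_pos_eq; lra. }
  apply CV_disk_inside in H2. revert H2. apply ex_series_ext. intros n. unfold PS_derive, c.
  match goal with |- @eq _ ?x ?y => change (@eq R x y) end.
  rewrite Rabs_pos_eq. ring. rewrite Rmult_1_r.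
  repeat apply Rmult_le_pos; try apply pos_INR. now apply pow_le.
Qed.

Lemma ex_cps_bound b r K z : Cmod z < r ->
  (forall n, Cmod (b n) * r ^ n <= INR (S n) * INR (S (S n)) * K) -> exists l : C, cps b z l.
Proof.
  intros Hz HK. assert (Hz0 := Cmod_ge_0 z).
  assert (X : ex_series (K := C_AbsRing) (V := C_CompleteNormedModule) (fun n => z ^ n * b n)%C).
  { apply (ex_series_le (V := C_CompleteNormedModule) _ (fun n => K * (INR (S n) * INR (S (S n)) * (Cmod z / r) ^ n))).
    - intros n. change (Cmod (z ^ n * b n) <= K * (INR (S n) * INR (S (S n)) * (Cmod z / r) ^ n)).
      rewrite Cmod_mult, Cmod_pow. unfold Rdiv. rewrite Rpow_mult_distr, pow_inv.
      assert (Hr : 0 < r ^ n) by (apply pow_lt; lra).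
      replace (Cmod z ^ n * Cmod (b n)) with ((Cmod (b n) * r ^ n) * (Cmod z ^ n * / r ^ n)) by (field; lra).
      replace (K * (INR (S n) * INR (S (S n)) * (Cmod z ^ n * / r ^ n)))
        with ((INR (S n) * INR (S (S n)) * K) * (Cmod z ^ n * / r ^ n)) by ring.
      apply Rmult_le_compat_r; auto. apply Rmult_le_pos. now apply pow_le. left; now apply Rinv_0_lt_compat.
    - apply (ex_series_scal (K := R_AbsRing) (V := R_NormedModule) K (fun m => INR (S m) * INR (S (S m)) * (Cmod z / r) ^ m)).
      apply ex_series_second. split.
      apply Rmult_le_pos; auto. left; apply Rinv_0_lt_compat; lra.
      apply Rmult_lt_reg_r with r. lra. unfold Rdiv. rewrite Rmult_assoc, Rinv_l; lra. }
  destruct X as [l Hl]. exists l. apply cps_series. exact Hl.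
Qed.

Lemma cseries_bound u l b s : cseries u l -> is_series b s ->
  (forall n, Cmod (u n) <= b n) -> Cmod l <= s.
Proof.
  intros Hu Hb H.
  assert (Hs : forall n, Cmod (csum u n) <= sum_n b n).
  { induction n. rewrite csum_0, sum_O. apply H. rewrite csum_S, sum_Sn.
    eapply Rle_trans. apply Cmod_triangle. apply Rplus_le_compat; auto. }
  apply Rle_plus_epsilon. intros eps He.
  destruct (proj1 (cseries_eps u l) Hu (eps / 2)) as [N1 H1]; [lra|].
  assert (Hb' : is_lim_seq (sum_n b) s) by exact Hb.
  apply is_lim_seq_spec in Hb'. destruct (Hb' (mkposreal (eps / 2) ltac:(lra))) as [N2 H2]. simpl in H2.
  set (n := (N1 + N2)%nat). specialize (H1 n ltac:(unfold n; lia)). specialize (H2 n ltac:(unfold n; lia)).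
  specialize (Hs n). apply Rabs_def2 in H2.
  assert (T := Cmod_minus_lower l (csum u n)). rewrite <- (Cmod_opp (l - csum u n)) in T.
  replace (- (l - csum u n))%C with (csum u n - l)%C in T by ring. lra.
Qed.

(** The remainders [T m = w ^ m - z ^ m - m z ^ (m - 1) (w - z)] satisfy
    [T (m + 1) = w * T m + m z ^ (m - 1) (w - z) ^ 2]. *)
Lemma pow_remainder z w r n : Cmod z <= r -> Cmod w <= r ->
  Cmod (w ^ S (S n) - z ^ S (S n) - INR (S (S n)) * z ^ S n * (w - z)) <=
  INR (S n) * INR (S (S n)) * r ^ n * Cmod (w - z) ^ 2.
Proof.
  intros Hz Hw. assert (Hr : 0 <= r) by (assert (H := Cmod_ge_0 z); lra).
  assert (Hd := Cmod_ge_0 (w - z)).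
  induction n.
  - replace (w ^ 2 - z ^ 2 - INR 2 * z ^ 1 * (w - z))%C with ((w - z) * (w - z))%C.
    rewrite Cmod_mult. simpl. nra.
    replace (RtoC (INR 2)) with (1 + 1)%C by (apply injective_projections; simpl; ring). simpl. ring.
  - set (m := S (S n)) in *.
    replace (w ^ S m - z ^ S m - INR (S m) * z ^ m * (w - z))%C with
      (w * (w ^ m - z ^ m - INR m * z ^ S n * (w - z)) + INR m * z ^ S n * ((w - z) * (w - z)))%C.
    2: { rewrite (S_INR m), RtoC_plus. change (z ^ S m)%C with (z * z ^ m)%C. change (z ^ m)%C with (z * z ^ S n)%C.
         change (w ^ S m)%C with (w * w ^ m)%C. ring. }
    eapply Rle_trans. apply Cmod_triangle. rewrite !Cmod_mult, Cmod_pow, Cmod_R, Rabs_pos_eq by apply pos_INR.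
    set (d := Cmod (w - z)) in *. set (T := Cmod (w ^ m - _ - _)) in *.
    assert (HT : Cmod w * T <= r * (INR (S n) * INR m * r ^ n * d ^ 2)).
    { apply Rmult_le_compat; auto. apply Cmod_ge_0. apply Cmod_ge_0. }
    assert (HP : Cmod z ^ S n <= r ^ S n) by (apply pow_incr; split; auto; apply Cmod_ge_0).
    assert (Hm := pos_INR m).
    assert (HU : INR m * Cmod z ^ S n * (d * d) <= INR m * r ^ S n * (d * d)).
    { apply Rmult_le_compat_r. nra. apply Rmult_le_compat_l; auto. }
    assert (Hrn : 0 <= r ^ n) by now apply pow_le.
    assert (HF : 0 <= INR m * (r * r ^ n) * (d * d)).
    { apply Rmult_le_pos; [apply Rmult_le_pos; auto|]; apply Rmult_le_pos; auto. }
    rewrite (S_INR m). change (INR m) with (INR (S (S n))) in *. rewrite (S_INR (S n)) in *.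
    simpl (r ^ S n) in *. simpl (d ^ 2) in *. set (N := INR (S n)) in *. nra.
Qed.

Definition cps_derive (a : nat -> C) (n : nat) : C := (INR (S n) * a (S n))%C.

(** Summing [pow_remainder] against the coefficients bounds the error of the
    linear approximation by a constant times [|w - z| ^ 2]. The radii [r0 < r1]
    leave room for a geometric majorant of the coefficients. *)
Lemma cps_derive_at f a rho z : has_ps f a rho -> Cmod z < rho ->
  exists l : C, cps (cps_derive a) z l /\ cderive f z l.
Proof.
  intros Hf Hz. assert (Hz0 := Cmod_ge_0 z).
  set (r0 := (2 * Cmod z + rho) / 3). set (r1 := (Cmod z + 2 * rho) / 3).
  assert (R0 : Cmod z < r0) by (unfold r0; lra). assert (R01 : r0 < r1) by (unfold r0, r1; lra).
  assert (R1 : r1 < rho) by (unfold r1; lra).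
  destruct (cps_coef_bound a r1 (f r1)) as [K [HK0 HK]]. lra.
  { apply Hf. rewrite Cmod_R, Rabs_pos_eq; lra. }
  destruct (ex_cps_bound (cps_derive a) r1 (K / r1) z) as [l Hl]. lra.
  { intros n. unfold cps_derive. rewrite Cmod_mult, Cmod_R, Rabs_pos_eq by apply pos_INR.
    specialize (HK (S n)).
    apply Rmult_le_reg_r with r1. lra.
    replace (INR (S n) * INR (S (S n)) * (K / r1) * r1) with (INR (S n) * INR (S (S n)) * K) by (field; lra).
    simpl (r1 ^ S n) in HK. assert (P1 := pos_INR n). rewrite !S_INR.
    apply Rle_trans with ((INR n + 1) * K).
    replace ((INR n + 1) * Cmod (a (S n)) * r1 ^ n * r1) with ((INR n + 1) * (Cmod (a (S n)) * (r1 * r1 ^ n))) by ring.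
    apply Rmult_le_compat_l; lra. apply Rmult_le_compat_r. auto. nra. }
  exists l. split; auto.
  set (B := fun n => match n with S (S m) => K / r1 ^ 2 * (INR (S m) * INR (S (S m)) * (r0 / r1) ^ m) | _ => 0 end).
  assert (EB : ex_series B).
  { apply (ex_series_incr_n (K := R_AbsRing) (V := R_NormedModule) B 2). simpl.
    apply (ex_series_scal (K := R_AbsRing) (V := R_NormedModule) (K / r1 ^ 2)
      (fun m => INR (S m) * INR (S (S m)) * (r0 / r1) ^ m)).
    apply ex_series_second. split. apply Rmult_le_pos; [lra|]. left; apply Rinv_0_lt_compat; lra.
    apply Rmult_lt_reg_r with r1. lra. unfold Rdiv. rewrite Rmult_assoc, Rinv_l; lra. }
  assert (main : forall w, Cmod w <= r0 -> Cmod (f w - f z - l * (w - z)) <= Series B * Cmod (w - z) ^ 2).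
  { intros w Hw.
    set (D := fun n => (a n * (w ^ n - z ^ n - (match n with O => 0 | S m => INR n * z ^ m end) * (w - z)))%C).
    assert (HD : cseries D (f w - f z - l * (w - z))%C).
    { assert (Sw := proj1 (cps_series _ _ _) (Hf w ltac:(lra))).
      assert (Sz := proj1 (cps_series _ _ _) (Hf z ltac:(lra))).
      assert (Sl : cseries (fun n => match n with O => 0 | S m => INR n * z ^ m * a n end)%C l).
      { replace l with (0 + l)%C by ring. apply (cseries_shift (fun n => _)).
        rewrite cps_series in Hl. revert Hl. apply cseries_ext. intros n. unfold cps_derive. ring. }
      replace (f w - f z - l * (w - z))%C with (f w - f z - (w - z) * l)%C by ring.
      generalize (cseries_minus _ _ _ _ (cseries_minus _ _ _ _ Sw Sz) (cseries_scal (w - z) _ _ Sl)).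
      apply cseries_ext. intros n. unfold D. destruct n; ring. }
    apply (cseries_bound D _ (fun n => B n * Cmod (w - z) ^ 2)); auto.
    { apply is_series_scal_r. now apply Series_correct. }
    intros n. unfold D, B. destruct n as [|[|n]].
    - replace (_ * _)%C with (RtoC 0). rewrite Cmod_0. lra. simpl. ring.
    - replace (_ * _)%C with (RtoC 0). rewrite Cmod_0. lra. simpl. ring.
    - rewrite Cmod_mult.
      assert (PR := pow_remainder z w r0 n ltac:(lra) Hw).
      specialize (HK (S (S n))).
      assert (P : 0 < r1 ^ n) by (apply pow_lt; lra).
      unfold Rdiv at 2. rewrite Rpow_mult_distr, pow_inv.
      apply Rle_trans with (Cmod (a (S (S n))) * (INR (S n) * INR (S (S n)) * r0 ^ n * Cmod (w - z) ^ 2)).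
      apply Rmult_le_compat_l; auto. apply Cmod_ge_0.
      replace (Cmod (a (S (S n))) * (INR (S n) * INR (S (S n)) * r0 ^ n * Cmod (w - z) ^ 2)) with
        ((Cmod (a (S (S n))) * r1 ^ S (S n)) * (INR (S n) * INR (S (S n)) * r0 ^ n * Cmod (w - z) ^ 2 * / r1 ^ n * / r1 ^ 2))
        by (simpl; field; split; lra).
      replace (K / r1 ^ 2 * (INR (S n) * INR (S (S n)) * (r0 ^ n * / r1 ^ n)) * Cmod (w - z) ^ 2) with
        (K * (INR (S n) * INR (S (S n)) * r0 ^ n * Cmod (w - z) ^ 2 * / r1 ^ n * / r1 ^ 2)) by (unfold Rdiv; ring).
      apply Rmult_le_compat_r; auto.
      assert (0 <= / r1 ^ n) by (left; now apply Rinv_0_lt_compat).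
      assert (0 <= / r1 ^ 2) by (left; apply Rinv_0_lt_compat, pow_lt; lra).
      assert (0 <= r0 ^ n) by (apply pow_le; lra).
      assert (0 <= Cmod (w - z) ^ 2) by (apply pow_le, Cmod_ge_0).
      repeat (apply Rmult_le_pos; [|assumption]). apply Rmult_le_pos; apply pos_INR. }
  assert (SB : 0 <= Series B).
  { assert (M := main z ltac:(lra)). apply Rnot_lt_le. intros Hlt.
    assert (M' := main r0). rewrite Cmod_R, Rabs_pos_eq in M' by lra. specialize (M' ltac:(lra)).
    assert (P : 0 < Cmod (r0 - z)). { assert (L := Cmod_minus_lower r0 z). rewrite Cmod_R, Rabs_pos_eq in L; lra. }
    assert (P2 := Cmod_ge_0 (f r0 - f z - l * (r0 - z))).
    assert (P3 : 0 < Cmod (r0 - z) ^ 2) by now apply pow_lt. nra. }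
  apply cderive_eps. intros eps He.
  exists (Rmin (r0 - Cmod z) (eps / (Series B + 1))). split.
  { apply Rmin_pos. lra. apply Rdiv_lt_0_compat; lra. }
  intros w Hw. assert (W1 := Rlt_le_trans _ _ _ Hw (Rmin_l _ _)). assert (W2 := Rlt_le_trans _ _ _ Hw (Rmin_r _ _)).
  assert (L := Cmod_minus_lower w z). assert (P := Cmod_ge_0 (w - z)).
  eapply Rle_trans. apply main. lra.
  replace (Series B * Cmod (w - z) ^ 2) with ((Series B * Cmod (w - z)) * Cmod (w - z)) by ring.
  apply Rmult_le_compat_r; auto.
  apply Rle_trans with ((Series B + 1) * (eps / (Series B + 1))).
  apply Rmult_le_compat; lra. right; field; lra.
Qed.

Theorem has_ps_derive f a rho : has_ps f a rho -> has_ps (C_derive f) (cps_derive a) rho.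
Proof.
  intros H z Hz. destruct (cps_derive_at f a rho z H Hz) as [l [H1 H2]].
  now rewrite (is_C_derive_unique f z l H2).
Qed.

Theorem has_ps_cderive f a rho z : has_ps f a rho -> Cmod z < rho -> cderive f z (C_derive f z).
Proof.
  intros H Hz. destruct (cps_derive_at f a rho z H Hz) as [l [H1 H2]].
  now rewrite (is_C_derive_unique f z l H2).
Qed.

Lemma cps_unique a z l m : cps a z l -> cps a z m -> l = m.
Proof.
  intros H1 H2. exact (filterlim_locally_unique (K := C_AbsRing) (V := C_NormedModule) _ _ _ H1 H2).
Qed.

Lemma has_ps_0 f a rho : 0 < rho -> has_ps f a rho -> f 0 = a 0%nat.
Proof.
  intros Hr H. apply (cps_unique a 0). apply H. now rewrite Cmod_0.
  apply (is_pseries_0 (K := C_AbsRing) (V := C_NormedModule)).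
Qed.

Lemma INR_S_neq_0 n : RtoC (INR (S n)) <> 0.
Proof. intros X. apply RtoC_inj in X. now apply not_0_INR in X. Qed.

(** Evaluation at 0 gives the coefficient of index 0; the others are reached by
    differentiating. *)
Theorem has_ps_unique n : forall f a b rho, 0 < rho -> has_ps f a rho -> has_ps f b rho -> a n = b n.
Proof.
  induction n; intros f a b rho Hr Ha Hb.
  - now rewrite <- (has_ps_0 f a rho), <- (has_ps_0 f b rho).
  - assert (E := IHn _ _ _ _ Hr (has_ps_derive _ _ _ Ha) (has_ps_derive _ _ _ Hb)).
    unfold cps_derive in E.
    assert (Hn := INR_S_neq_0 n).
    replace (a (S n)) with (/ INR (S n) * (INR (S n) * a (S n)))%C by (field; auto).
    rewrite E. field; auto.
Qed.

(** * Logarithmic coefficients *)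

Lemma has_ps_le f a r rho : r <= rho -> has_ps f a rho -> has_ps f a r.
Proof. intros Hr H z Hz. apply H. lra. Qed.

Lemma has_ps_cdiff f a rho z : has_ps f a rho -> Cmod z < rho -> cdiff f z.
Proof. intros H Hz. exists (C_derive f z). exact (has_ps_cderive f a rho z H Hz). Qed.

Lemma C_derive_eq_on f h r z m : (forall w, Cmod w < r -> f w = h w) -> Cmod z < r ->
  cderive h z m -> C_derive f z = m.
Proof.
  intros H Hz Hh. apply is_C_derive_unique. revert Hh. apply cderive_ext_loc.
  exists (r - Cmod z). split. lra. intros w Hw. symmetry. apply H.
  assert (L := Cmod_minus_lower w z). lra.
Qed.

(** The singularity of [f z / z] at 0 is removed by the shifted series. *)
Lemma has_ps_div_z f a rho : has_ps f a rho -> a 0%nat = 0 ->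
  exists g, has_ps g (fun n => a (S n)) rho /\ forall z, Cmod z < rho -> f z = (z * g z)%C.
Proof.
  intros Hf Ha. exists (fun z => if Ceq_dec z 0 then a 1%nat else (f z / z)%C). split.
  - intros z Hz. destruct (Ceq_dec z 0) as [->|Hz0].
    apply (is_pseries_0 (K := C_AbsRing) (V := C_NormedModule) (fun n => a (S n))).
    replace (f z / z)%C with (/ z * (f z + - a 0%nat))%C. 2: { rewrite Ha. field; auto. }
    apply (is_pseries_decr_1 (K := C_AbsRing) (V := C_NormedModule) a z (/ z)%C (f z)).
    now apply Cinv_l. now apply Hf.
  - intros z Hz. destruct (Ceq_dec z 0) as [->|Hz0].
    rewrite (has_ps_0 f a rho); auto. rewrite Ha; ring. rewrite Cmod_0 in Hz. auto. field; auto.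
Qed.

Lemma cseries_0 : cseries (fun _ => 0) 0.
Proof.
  apply cseries_eps. intros eps He. exists 0%nat. intros n _.
  assert (E : csum (fun _ => 0) n = 0). { induction n. apply csum_0. rewrite csum_S, IHn. ring. }
  rewrite E. replace (0 - 0)%C with (RtoC 0) by ring. now rewrite Cmod_0.
Qed.

(** All Taylor coefficients but the first vanish, by uniqueness. *)
Lemma cderive_0_constant h rho z : (forall w, Cmod w < rho -> cderive h w 0) -> Cmod z < rho -> h z = h 0.
Proof.
  intros H Hz. assert (Hz0 := Cmod_ge_0 z).
  destruct (taylor h rho) as [a [Ha _]]. lra. { intros w Hw. exists (RtoC 0). now apply H. }
  assert (Hd : has_ps (C_derive h) (fun _ => 0) rho).
  { intros w Hw. rewrite (is_C_derive_unique h w 0 (H w Hw)). apply cps_series.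
    generalize cseries_0. apply cseries_ext. intros n. ring. }
  rewrite (has_ps_0 h a rho); auto. 2: lra.
  apply (cps_unique a z). now apply Ha. apply cps_series.
  replace (a 0%nat) with (z ^ 0 * a 0%nat + 0)%C by (simpl; ring).
  apply (cseries_shift (fun n => z ^ n * a n)%C). generalize cseries_0. apply cseries_ext.
  intros n. assert (E := has_ps_unique n _ _ _ rho ltac:(lra) (has_ps_derive _ _ _ Ha) Hd).
  unfold cps_derive in E.
  assert (Hn := INR_S_neq_0 n).
  replace (z ^ S n * a (S n))%C with (z ^ S n * / INR (S n) * (INR (S n) * a (S n)))%C by (field; auto).
  rewrite E. ring.
Qed.

(** A series exists for any sequence dominated by the coefficients of a known
    one; the shift by one index is what integration needs. *)
Lemma has_ps_bounded_coefs f a b rho : has_ps f a rho ->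
  (exists M, 0 <= M /\ forall n, Cmod (b (S n)) <= M * Cmod (a n)) ->
  exists g, has_ps g b rho.
Proof.
  intros Hf [M [HM Hb]]. exists (fun z => epsilon (inhabits (RtoC 0)) (cps b z)).
  intros z Hz. apply epsilon_spec. assert (Hz0 := Cmod_ge_0 z).
  set (r := (Cmod z + rho) / 2). assert (Hr : Cmod z < r) by (unfold r; lra).
  assert (Hr' : r < rho) by (unfold r; lra).
  destruct (cps_coef_bound a r (f r)) as [K [HK0 HK]]. lra.
  { apply Hf. rewrite Cmod_R, Rabs_pos_eq; lra. }
  assert (HMKr : 0 <= M * K * r) by (apply Rmult_le_pos; [apply Rmult_le_pos|]; lra).
  assert (Hb0 := Cmod_ge_0 (b 0%nat)).
  apply (ex_cps_bound b r (M * K * r + Cmod (b 0%nat))); auto. intros n.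
  apply Rle_trans with (M * K * r + Cmod (b 0%nat)).
  - destruct n. simpl; lra.
    assert (Hrn : 0 <= r ^ n) by (apply pow_le; lra).
    apply Rle_trans with (M * Cmod (a n) * (r * r ^ n)).
    simpl. apply Rmult_le_compat_r. apply Rmult_le_pos; lra. auto.
    specialize (HK n). replace (M * Cmod (a n) * (r * r ^ n)) with (M * r * (Cmod (a n) * r ^ n)) by ring.
    assert (M * r * (Cmod (a n) * r ^ n) <= M * r * K). { apply Rmult_le_compat_l; auto. apply Rmult_le_pos; lra. }
    lra.
  - rewrite <- (Rmult_1_l (M * K * r + Cmod (b 0%nat))) at 1. apply Rmult_le_compat_r. lra.
    rewrite !S_INR. assert (H := pos_INR n). nra.
Qed.

Lemma has_ps_ext_coefs f a b rho : (forall n, a n = b n) -> has_ps f a rho -> has_ps f b rho.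
Proof. intros E H z Hz. apply (is_pseries_ext (K := C_AbsRing) (V := C_NormedModule) a b); auto. now apply H. Qed.

Lemma ccont_neq_0 g : ccont g 0 -> g 0 <> 0 -> exists d, 0 < d /\ forall z, Cmod z < d -> g z <> 0.
Proof.
  intros Hg H0. rewrite continuous_Cmod in Hg.
  destruct (Hg (Cmod (g 0))) as [d [D1 D2]]. now apply Cmod_gt_0.
  exists d; split; auto. intros z Hz E. specialize (D2 z). rewrite E in D2.
  replace (z - 0)%C with z in D2 by ring. specialize (D2 Hz).
  replace (0 - g 0)%C with (- g 0)%C in D2 by ring. rewrite Cmod_opp in D2. lra.
Qed.

(** The series [L] is the primitive of [g' / g] vanishing at 0; then
    [g * exp (- L)] has derivative 0 and equals 1. *)
Theorem power_series_log g b rho : 0 < rho -> has_ps g b rho -> b 0%nat = 1 ->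
  exists r L l, 0 < r <= rho /\ has_ps L l r /\ l 0%nat = 0 /\
    forall z, Cmod z < r -> Cexp (L z) = g z.
Proof.
  intros Hrho Hg Hb.
  assert (g0 : g 0 = 1) by (rewrite <- Hb; now apply (has_ps_0 g b rho)).
  destruct (ccont_neq_0 g) as [d [D1 D2]].
  { apply cdiff_ccont. apply (has_ps_cdiff g b rho); auto. now rewrite Cmod_0. }
  { rewrite g0. intros X. apply RtoC_inj in X. lra. }
  set (r := Rmin d rho). assert (Hr : 0 < r) by (apply Rmin_pos; auto).
  assert (Hr1 : r <= d) by apply Rmin_l. assert (Hr2 : r <= rho) by apply Rmin_r.
  destruct (taylor (fun z => C_derive g z / g z)%C r Hr) as [q [Hq _]].
  { intros w Hw. eexists. apply cderive_div.
    apply (has_ps_cderive (C_derive g) (cps_derive b) rho). now apply has_ps_derive. lra.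
    apply (has_ps_cderive g b rho); auto. lra. apply D2; lra. }
  set (l := fun n => match n with O => RtoC 0 | S m => (/ INR (S m) * q m)%C end).
  destruct (has_ps_bounded_coefs _ _ l r Hq) as [L HL].
  { exists 1. split. lra. intros n. change (l (S n)) with (/ INR (S n) * q n)%C.
    rewrite Cmod_mult, Cmod_inv by apply INR_S_neq_0.
    apply Rmult_le_compat_r. apply Cmod_ge_0. rewrite Cmod_R, Rabs_pos_eq by apply pos_INR.
    rewrite <- Rinv_1. apply Rinv_le_contravar. lra. rewrite S_INR. assert (H := pos_INR n). lra. }
  exists r, L, l. split; [lra|]. split; [auto|]. split; [auto|].
  assert (L' : forall z, Cmod z < r -> C_derive L z = (C_derive g z / g z)%C).
  { intros z Hz. apply (cps_unique q z); [|exact (Hq z Hz)].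
    refine (has_ps_ext_coefs _ (cps_derive l) q r _ (has_ps_derive L l r HL) z Hz).
    intros n. unfold cps_derive, l. field. apply INR_S_neq_0. }
  assert (HC : forall z, Cmod z < r -> (g z * Cexp (- L z))%C = (g 0 * Cexp (- L 0))%C).
  { intros z Hz. apply (cderive_0_constant (fun z => g z * Cexp (- L z))%C r); auto.
    intros w Hw. eapply cderive_eq. apply cderive_mult. apply (has_ps_cderive g b rho); auto; lra.
    apply (cderive_comp Cexp (fun w => - L w)%C). apply cderive_Cexp.
    apply cderive_opp. apply (has_ps_cderive L l r); auto.
    rewrite L' by auto. field. apply D2. lra. }
  intros z Hz.
  assert (L0 : L 0 = 0) by (apply (has_ps_0 L l r); auto).
  replace (Cexp (L z)) with ((g z * Cexp (- L z)) * Cexp (L z))%C.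
  rewrite <- Cmult_assoc, <- Cexp_plus. replace (- L z + L z)%C with (RtoC 0) by ring. rewrite Cexp_0. ring.
  rewrite HC, g0, L0 by auto. replace (- (0))%C with (RtoC 0) by ring. rewrite Cexp_0. ring.
Qed.

(** The description operator defining [log_coeff] is only meaningful once a
    logarithm of [f z / z] with a power series is known to exist. *)
Lemma log_coeff_spec f a : has_ps f a 1 -> a 0%nat = 0 -> a 1%nat = 1 -> is_log_coeffs f (log_coeff f).
Proof.
  intros Hf H0 H1. unfold log_coeff. apply epsilon_spec.
  destruct (has_ps_div_z f a 1 Hf H0) as [g [Hg Hfg]].
  destruct (power_series_log g _ 1 Rlt_0_1 Hg H1) as [r [L [l [Hr [HL [Hl HE]]]]]].
  exists (fun n => / 2 * l n)%C. split. rewrite Hl. ring.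
  exists r, L. split; [lra|]. split. split.
  - transitivity (l 0%nat); auto. apply (has_ps_0 L l r); auto. lra.
  - intros z Hz. split. apply cdiff_ccont. now apply (has_ps_cdiff L l r).
    intros Hz0. rewrite HE, Hfg by lra. field; auto.
  - intros z Hz. apply (has_ps_ext_coefs L l (fun n => 2 * (/ 2 * l n))%C r); auto.
    intros n. field.
Qed.

(** For [f z = z * g z] and [g = exp L] one has [g' = L' g]. This equation and
    its first two derivatives at 0 determine the coefficients of [L]
    successively. *)
Theorem log_coeff_values f a : has_ps f a 1 -> a 0%nat = 0 -> a 1%nat = 1 ->
  log_coeff f 1 = (a 2%nat / 2)%C /\
  log_coeff f 2 = ((a 3%nat - a 2%nat * a 2%nat / 2) / 2)%C /\
  log_coeff f 3 = ((a 4%nat - a 2%nat * a 3%nat + a 2%nat * a 2%nat * a 2%nat / 3) / 2)%C.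
Proof.
  intros Hf H0 H1. assert (HS := log_coeff_spec f a Hf H0 H1).
  set (gam := log_coeff f) in *. destruct HS as [G0 [r0 [L [Hr0 [[L0 HL] HP]]]]].
  destruct (has_ps_div_z f a 1 Hf H0) as [g [Hg Hfg]].
  set (r := Rmin r0 1). assert (Hr : 0 < r) by (apply Rmin_pos; lra).
  assert (Hra : r <= r0) by apply Rmin_l. assert (Hrb : r <= 1) by apply Rmin_r.
  assert (Lp : has_ps L (fun n => 2 * gam n)%C r). { intros z Hz. apply HP. lra. }
  apply (has_ps_le g _ r) in Hg; auto.
  assert (E : forall z, Cmod z < r -> g z = Cexp (L z)).
  { intros z Hz. destruct (Ceq_dec z 0) as [->|Hz0].
    rewrite L0, Cexp_0, <- H1. now apply (has_ps_0 g _ r Hr) in Hg.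
    rewrite (proj2 (HL z ltac:(lra)) Hz0), Hfg by lra. field; auto. }
  assert (L1 := has_ps_derive _ _ _ Lp). assert (L2 := has_ps_derive _ _ _ L1). assert (L3 := has_ps_derive _ _ _ L2).
  assert (g1 := has_ps_derive _ _ _ Hg). assert (g2 := has_ps_derive _ _ _ g1). assert (g3 := has_ps_derive _ _ _ g2).
  assert (E1 : forall z, Cmod z < r -> C_derive g z = (C_derive L z * g z)%C).
  { intros z Hz. apply (C_derive_eq_on g (fun z => Cexp (L z)) r z); auto. rewrite E by auto.
    apply (cderive_comp Cexp L). apply cderive_Cexp. apply (has_ps_cderive L _ r z Lp Hz). }
  assert (E2 : forall z, Cmod z < r -> C_derive (C_derive g) z =
    (C_derive (C_derive L) z * g z + C_derive L z * C_derive g z)%C).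
  { intros z Hz. apply (C_derive_eq_on _ (fun z => C_derive L z * g z)%C r z); auto.
    apply cderive_mult. apply (has_ps_cderive _ _ r z L1 Hz). apply (has_ps_cderive _ _ r z Hg Hz). }
  assert (E3 : forall z, Cmod z < r -> C_derive (C_derive (C_derive g)) z =
    (C_derive (C_derive (C_derive L)) z * g z + C_derive (C_derive L) z * C_derive g z +
    (C_derive (C_derive L) z * C_derive g z + C_derive L z * C_derive (C_derive g) z))%C).
  { intros z Hz.
    apply (C_derive_eq_on _ (fun z => C_derive (C_derive L) z * g z + C_derive L z * C_derive g z)%C r z); auto.
    apply cderive_plus; apply cderive_mult; (eapply has_ps_cderive; [|exact Hz]); eassumption. }
  assert (Z : Cmod 0 < r) by now rewrite Cmod_0.
  specialize (E1 0 Z). specialize (E2 0 Z). specialize (E3 0 Z).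
  rewrite (has_ps_0 _ _ r Hr g1), (has_ps_0 _ _ r Hr L1) in E1, E2, E3.
  rewrite (has_ps_0 _ _ r Hr Hg) in E1, E2, E3.
  rewrite (has_ps_0 _ _ r Hr g2), (has_ps_0 _ _ r Hr L2) in E2, E3.
  rewrite (has_ps_0 _ _ r Hr g3), (has_ps_0 _ _ r Hr L3) in E3.
  unfold cps_derive in E1, E2, E3. rewrite H1 in E1, E2, E3.
  assert (I1 : RtoC (INR 1) = 1) by reflexivity.
  assert (I2 : RtoC (INR 2) = 2). { f_equal. }
  assert (I3 : RtoC (INR 3) = 3). { f_equal. simpl. ring. }
  rewrite I1 in E1. rewrite I1, I2 in E2. rewrite I1, I2, I3 in E3.
  assert (N2 : RtoC 2 <> 0) by (intros X; apply RtoC_inj in X; lra).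
  assert (N3 : RtoC 3 <> 0) by (intros X; apply RtoC_inj in X; lra).
  set (a2 := a 2%nat) in *. set (a3 := a 3%nat) in *. set (a4 := a 4%nat) in *.
  assert (F1 : gam 1%nat = (a2 / 2)%C).
  { replace a2 with (1 * a2)%C by ring. rewrite E1. field; auto. }
  assert (F2 : gam 2%nat = ((a3 - a2 * a2 / 2) / 2)%C).
  { replace a3 with ((1 * (2 * a3)) / 2)%C by (field; auto). rewrite E2, F1. field; auto. }
  split; auto. split; auto.
  replace a4 with ((1 * (2 * (3 * a4))) / (2 * 3))%C by (field; auto). rewrite E3, F1, F2. field; auto.
Qed.

(** * Coefficients of functions with positive real part *)

Definition conj_cis (t : R) : C := Cconj (cis t).

Lemma cis_conj_cis t : (cis t * conj_cis t = 1)%C.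
Proof.
  unfold conj_cis, cis. assert (H := sin2_cos2 t). unfold Rsqr in H.
  apply injective_projections; simpl; lra.
Qed.

Lemma rcont_cis t : rcont cis t.
Proof. apply rcont_pair. apply continuous_cos. apply continuous_sin. Qed.

Lemma rcont_conj_cis t : rcont conj_cis t.
Proof. apply rcont_conj, rcont_cis. Qed.

(** The Cauchy coefficient formula written on the circle, where
    [/ w = conj_cis t / r]. *)
Lemma mean_conj_cis_pow p c r n : has_ps p c 1 -> 0 < r < 1 ->
  mean (fun t => p (r * cis t) * conj_cis t ^ n)%C = (c n * r ^ n)%C.
Proof.
  intros Hp Hr.
  destruct (taylor p 1 Rlt_0_1) as [a [Ha Hm]]. { intros w Hw. now apply (has_ps_cdiff p c 1). }
  rewrite <- (has_ps_unique n p a c 1 Rlt_0_1 Ha Hp), <- (Hm r n Hr).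
  assert (Hr0 : RtoC r <> 0) by (intros X; apply RtoC_inj in X; lra).
  assert (Hc : forall t, cis t <> 0) by (intros t; apply Cmod_gt_0; rewrite Cmod_cis; lra).
  unfold circle_mean. rewrite Cmult_comm, <- mean_scal.
  - apply mean_ext. intros t _.
    replace (/ (r * cis t))%C with (/ r * conj_cis t)%C.
    rewrite Cpow_mult_l, Cpow_inv by auto. field. now apply Cpow_nz.
    replace (conj_cis t) with (/ cis t * (cis t * conj_cis t))%C by (field; auto).
    rewrite cis_conj_cis. field; auto.
  - intros t Ht. apply rcont_mult. apply (per_cont_circle p); auto. lra.
    intros z Hz. apply cdiff_ccont, (has_ps_cdiff p c 1); auto. lra.
    apply rcont_pow, rcont_inv. apply rcont_circle. apply Cmult_neq_0; auto.
Qed.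

(** The mean value property of [p w * w ^ (n + 1)], which vanishes at 0. *)
Lemma mean_cis_pow p c r n : has_ps p c 1 -> 0 < r < 1 ->
  mean (fun t => p (r * cis t) * cis t ^ S n)%C = 0.
Proof.
  intros Hp Hr.
  assert (Hr0 : RtoC r <> 0) by (intros X; apply RtoC_inj in X; lra).
  assert (D : forall m z, Cmod z < 1 -> cdiff (fun w => p w * w ^ m)%C z).
  { intros m z Hz. apply cdiff_mult. now apply (has_ps_cdiff p c 1). apply cdiff_pow, cdiff_id. }
  assert (M := mean_value (fun w => p w * w ^ S n)%C 1 0).
  assert (M' := M (fun z Hz => cdiff_ccont _ _ (D _ z Hz)) (fun z Hz _ => D _ z Hz) r ltac:(lra)).
  assert (E : circle_mean (fun w => p w * w ^ S n)%C r = (r ^ S n * mean (fun t => p (r * cis t) * cis t ^ S n))%C).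
  { rewrite <- mean_scal. apply mean_ext. intros t _. rewrite Cpow_mult_l. ring.
    intros t Ht. apply rcont_mult. apply (per_cont_circle p); auto. lra.
    intros z Hz. apply cdiff_ccont, (has_ps_cdiff p c 1); auto. lra. apply rcont_pow, rcont_cis. }
  rewrite E in M'. cbv beta in M'.
  rewrite (Cpow_S 0 n), Cmult_0_l, Cmult_0_r in M'.
  assert (Hrn : (r ^ S n)%C <> 0) by now apply Cpow_nz.
  replace (mean _) with (/ r ^ S n * (r ^ S n * mean (fun t => p (r * cis t) * cis t ^ S n)))%C.
  rewrite M'. ring. field. auto.
Qed.

(** The limit [r -> 1], made explicit by Bernoulli's inequality. *)
Lemma pow_mult_le_limit n x : (forall r, 0 < r < 1 -> r ^ n * x <= 2) -> x <= 2.
Proof.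
  intros H. apply Rnot_lt_le. intros Hx.
  assert (B : forall s m, 0 <= s <= 1 -> 1 - INR m * s <= (1 - s) ^ m).
  { intros s m Hs. induction m. simpl; lra. rewrite S_INR. simpl. assert (P := pos_INR m).
    assert (A : 0 <= INR m * s) by (apply Rmult_le_pos; lra). nra. }
  set (s := (x - 2) / (2 * (INR n + 1) * x)).
  assert (P := pos_INR n).
  assert (D : 0 < 2 * (INR n + 1) * x) by (apply Rmult_lt_0_compat; lra).
  assert (Hs : 0 < s) by (apply Rdiv_lt_0_compat; lra).
  assert (Hsx : INR n * s * x <= (x - 2) / 2).
  { replace ((x - 2) / 2) with ((INR n + 1) * s * x) by (unfold s; field; lra).
    apply Rmult_le_compat_r. lra. apply Rmult_le_compat_r; lra. }
  assert (Hs1 : s < 1).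
  { apply Rmult_lt_reg_r with (2 * (INR n + 1) * x); auto. unfold s, Rdiv. rewrite Rmult_assoc, Rinv_l by lra. nra. }
  specialize (H (1 - s) ltac:(lra)). specialize (B s n ltac:(lra)).
  assert ((1 - INR n * s) * x <= (1 - s) ^ n * x) by (apply Rmult_le_compat_r; lra). lra.
Qed.

Lemma per_cont_cubic x0 x1 x2 x3 :
  per_cont (fun t => x0 + x1 * conj_cis t + x2 * conj_cis t ^ 2 + x3 * conj_cis t ^ 3)%C.
Proof.
  assert (M : forall x n t, rcont (fun s => x * conj_cis s ^ n)%C t).
  { intros x n t. apply rcont_mult. apply rcont_const. apply rcont_pow, rcont_conj_cis. }
  intros t _. apply rcont_plus; [apply rcont_plus; [apply rcont_plus|]|]; auto.
  apply rcont_const. apply rcont_mult. apply rcont_const. apply rcont_conj_cis.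
Qed.

Section Caratheodory.
Variables (p : C -> C) (c : nat -> C).
Hypothesis (Hp : has_ps p c 1) (Hc0 : c 0%nat = 1).
Hypothesis (Hpos : forall z, Cmod z < 1 -> 0 < Re (p z)).

Section Circle.
Variable r : R.
Hypothesis Hr : 0 < r < 1.

(** [Re p] on the circle of radius [r] is the density of a probability measure
    with moments [moment n / 2] for [n > 0]; all estimates of the coefficients come from
    integrating against it. *)
Definition density (t : R) : C := RtoC (Re (p (r * cis t)%C)).

Lemma per_cont_p : per_cont (fun t => p (r * cis t)%C).
Proof.
  apply per_cont_circle. lra. intros z Hz. apply cdiff_ccont, (has_ps_cdiff p c 1); auto. lra.
Qed.

Lemma density_pos t : 0 <= Re (p (r * cis t)%C).
Proof. left. apply Hpos. rewrite Cmod_circle; lra. Qed.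

Lemma per_cont_density : per_cont density.
Proof. intros t Ht. now apply rcont_RtoC, continuous_Re, per_cont_p. Qed.

Definition moment (n : nat) : C := (c n * r ^ n)%C.

Lemma density_split t x :
  (density t * x = / 2 * (p (r * cis t) * x) + / 2 * Cconj (p (r * cis t) * Cconj x))%C.
Proof. unfold density. rewrite Cmult_conj, Cconj_conj. rewrite re_alt. field. Qed.

Lemma mean_density_split x : per_cont x ->
  mean (fun t => density t * x t)%C =
  (/ 2 * mean (fun t => p (r * cis t) * x t) + / 2 * Cconj (mean (fun t => p (r * cis t) * Cconj (x t))))%C.
Proof.
  intros Hx.
  assert (H1 : per_cont (fun t => p (r * cis t) * x t)%C).
  { intros t Ht. apply rcont_mult; auto. now apply per_cont_p. }
  assert (H2 : per_cont (fun t => p (r * cis t) * Cconj (x t))%C).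
  { intros t Ht. apply rcont_mult; auto. now apply per_cont_p. apply rcont_conj; auto. }
  assert (H3 : per_cont (fun t => Cconj (p (r * cis t) * Cconj (x t)))%C).
  { intros t Ht. apply rcont_conj; auto. }
  rewrite <- mean_conj, <- !mean_scal, <- mean_plus; auto.
  apply mean_ext. intros t _. apply density_split.
  all: intros t Ht; apply rcont_mult; auto; apply rcont_const.
Qed.

Lemma mean_density_1 : mean (fun t => density t * 1)%C = 1.
Proof.
  rewrite mean_density_split. 2: intros t _; apply rcont_const.
  assert (E := mean_conj_cis_pow p c r 0 Hp Hr). simpl in E. rewrite Hc0 in E.
  replace (Cconj 1) with (RtoC 1) by (apply injective_projections; simpl; ring).
  rewrite E. apply injective_projections; simpl; field.
Qed.

Lemma mean_density_pow n : mean (fun t => density t * conj_cis t ^ S n)%C = (moment (S n) / 2)%C.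
Proof.
  rewrite mean_density_split. 2: intros t _; apply rcont_pow, rcont_conj_cis.
  rewrite (mean_ext (fun t => p (r * cis t) * Cconj (conj_cis t ^ S n))%C (fun t => p (r * cis t) * cis t ^ S n)%C).
  2: { intros t _. unfold conj_cis. now rewrite Cpow_conj, Cconj_conj. }
  rewrite (mean_cis_pow p c r n Hp Hr), (mean_conj_cis_pow p c r (S n) Hp Hr).
  replace (Cconj 0) with (RtoC 0) by (apply injective_projections; simpl; ring).
  unfold moment. field.
Qed.

Lemma mean_density_cubic x0 x1 x2 x3 :
  mean (fun t => density t * (x0 + x1 * conj_cis t + x2 * conj_cis t ^ 2 + x3 * conj_cis t ^ 3))%C =
  (x0 + (x1 * moment 1 + x2 * moment 2 + x3 * moment 3) / 2)%C.
Proof.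
  assert (P0 : per_cont (fun t => density t * 1)%C).
  { intros t Ht. apply rcont_mult. now apply per_cont_density. apply rcont_const. }
  assert (P : forall n, per_cont (fun t => density t * conj_cis t ^ n)%C).
  { intros n t Ht. apply rcont_mult. now apply per_cont_density. apply rcont_pow, rcont_conj_cis. }
  assert (Ps : forall x u, per_cont u -> per_cont (fun t => x * u t)%C).
  { intros x u Hu t Ht. apply rcont_mult; auto. apply rcont_const. }
  assert (Pp : forall u v, per_cont u -> per_cont v -> per_cont (fun t => u t + v t)%C).
  { intros u v Hu Hv t Ht. apply rcont_plus; auto. }
  rewrite (mean_ext _ (fun t => x0 * (density t * 1) + (x1 * (density t * conj_cis t ^ 1) +
    (x2 * (density t * conj_cis t ^ 2) + x3 * (density t * conj_cis t ^ 3))))%C) by (intros; simpl; ring).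
  rewrite mean_plus; auto.  rewrite mean_plus; auto.  rewrite mean_plus; auto.
  rewrite !mean_scal; auto.
  rewrite mean_density_1, !mean_density_pow. field.
Qed.

Definition sq_dev (t : R) : R := Cmod (conj_cis t - moment 1) ^ 2.

Lemma sq_dev_C t : RtoC (sq_dev t) = ((conj_cis t - moment 1) * Cconj (conj_cis t - moment 1))%C.
Proof. unfold sq_dev. apply Cmod2_conj. Qed.

Lemma continuous_sq_dev t : continuous sq_dev t.
Proof.
  apply (continuous_ext (fun t => Re ((conj_cis t - moment 1) * Cconj (conj_cis t - moment 1))%C)).
  intros s. now rewrite <- sq_dev_C.
  apply continuous_Re, rcont_mult; [|apply rcont_conj]; apply rcont_minus; try apply rcont_const; apply rcont_conj_cis.
Qed.

(** With [e = conj_cis t] and [m] the first [moment], [e] has modulus 1 and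
    mean [m / 2], so that [|e - m| ^ 2 = 1 - 2 Re (conj m * e) + |m| ^ 2] has
    mean [1 - |m| ^ 2 + |m| ^ 2]. This dictates the centre [m], twice
    the mean of [e]. *)
Lemma mean_sq_dev : mean (fun t => density t * sq_dev t)%C = 1.
Proof.
  set (affine := fun t => (1 + moment 1 * Cconj (moment 1) +
    (- Cconj (moment 1)) * conj_cis t + 0 * conj_cis t ^ 2 + 0 * conj_cis t ^ 3)%C).
  assert (Pd : per_cont (fun t => density t * affine t)%C).
  { intros t Ht. apply rcont_mult. now apply per_cont_density. now apply per_cont_cubic. }
  assert (Pe : per_cont (fun t => Cconj (density t * conj_cis t ^ 1))%C).
  { intros t Ht. apply rcont_conj, rcont_mult. now apply per_cont_density. apply rcont_pow, rcont_conj_cis. }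
  assert (Pe' : per_cont (fun t => density t * conj_cis t ^ 1)%C).
  { intros t Ht. apply rcont_mult. now apply per_cont_density. apply rcont_pow, rcont_conj_cis. }
  rewrite (mean_ext _ (fun t => density t * affine t - moment 1 * Cconj (density t * conj_cis t ^ 1))%C).
  - rewrite mean_minus by (auto; intros t Ht; apply rcont_mult; auto; apply rcont_const).
    unfold affine. rewrite mean_density_cubic, mean_scal, mean_conj, mean_density_pow; auto.
    unfold Cdiv. rewrite Cmult_conj, Cinv_conj by (intros X; apply RtoC_inj in X; lra).
    replace (Cconj 2) with (RtoC 2) by (apply injective_projections; simpl; ring).
    field.
  - intros t _. rewrite sq_dev_C, Cminus_conj, Cmult_conj, Cpow_conj.
    replace (Cconj (conj_cis t)) with (cis t) by (unfold conj_cis; now rewrite Cconj_conj).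
    replace (Cconj (density t)) with (density t) by (unfold density; apply injective_projections; simpl; ring).
    unfold affine. rewrite <- (cis_conj_cis t) at 1. simpl. ring.
Qed.

(** The constant 1 and [sq_dev] both have mean 1 against [density], so that a
    function dominated by an affine combination of them has mean at most 1 in
    modulus. *)
Lemma weighted_bound (phi : R -> C) u v : per_cont phi -> u + v = 1 ->
  (forall t, Cmod (phi t) <= u + v * sq_dev t) -> Cmod (mean (fun t => density t * phi t)%C) <= 1.
Proof.
  intros Hphi Huv H.
  assert (Pd : per_cont (fun t => density t * sq_dev t)%C).
  { intros t Ht. apply rcont_mult. now apply per_cont_density. apply rcont_RtoC, continuous_sq_dev. }
  assert (P1 : per_cont (fun t => density t * 1)%C).
  { intros t Ht. apply rcont_mult. now apply per_cont_density. apply rcont_const. }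
  assert (E : mean (fun t => RtoC (Re (p (r * cis t)%C) * (u + v * sq_dev t))) = 1).
  { rewrite (mean_ext _ (fun t => u * (density t * 1) + v * (density t * sq_dev t))%C).
    rewrite mean_plus, !mean_scal, mean_density_1, mean_sq_dev; auto.
    rewrite !Cmult_1_r, <- RtoC_plus, Huv. reflexivity.
    1,2: intros t Ht; apply rcont_mult; auto; apply rcont_const.
    intros t _. unfold density. rewrite RtoC_mult, RtoC_plus, RtoC_mult. ring. }
  apply Rle_trans with (Re (mean (fun t => RtoC (Re (p (r * cis t)%C) * (u + v * sq_dev t))))).
  2: { rewrite E. simpl. lra. }
  apply mean_le.
  - intros t Ht. apply rcont_mult; auto. now apply per_cont_density.
  - intros t Ht. apply (continuous_mult (K := R_AbsRing)).
    now apply continuous_Re, per_cont_p.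
    apply (continuous_plus (V := R_NormedModule)). apply continuous_const.
    apply (continuous_mult (K := R_AbsRing)). apply continuous_const. apply continuous_sq_dev.
  - intros t Ht. rewrite Cmod_mult. unfold density. rewrite Cmod_R, Rabs_pos_eq by apply density_pos.
    apply Rmult_le_compat_l; auto. apply density_pos.
Qed.

Lemma Cmod_conj_cis t : Cmod (conj_cis t) = 1.
Proof. unfold conj_cis. now rewrite Cmod_conj, Cmod_cis. Qed.

Lemma per_cont_test j k : per_cont (fun t => conj_cis t ^ j * (conj_cis t - moment 1) ^ k)%C.
Proof.
  intros t _. apply rcont_mult; apply rcont_pow. apply rcont_conj_cis.
  apply rcont_minus. apply rcont_conj_cis. apply rcont_const.
Qed.

(** [|e - m| ^ k] is dominated by [1], by [(1 + |e - m| ^ 2) / 2] and by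
    [|e - m| ^ 2] for [k = 0, 1, 2]. *)
Lemma mean_density_test_bound j k : (k <= 2)%nat ->
  Cmod (mean (fun t => density t * (conj_cis t ^ j * (conj_cis t - moment 1) ^ k))%C) <= 1.
Proof.
  intros Hk.
  assert (E : forall t, Cmod (conj_cis t ^ j * (conj_cis t - moment 1) ^ k) = Cmod (conj_cis t - moment 1) ^ k).
  { intros t. rewrite Cmod_mult, !Cmod_pow, Cmod_conj_cis, pow1. ring. }
  destruct k as [|[|[|k]]]; try lia.
  - apply (weighted_bound _ 1 0); [apply per_cont_test | lra |]. intros t. rewrite E. simpl. lra.
  - apply (weighted_bound _ (/ 2) (/ 2)); [apply per_cont_test | lra |]. intros t. rewrite E. unfold sq_dev.
    set (x := Cmod _). assert (Q := pow2_ge_0 (x - 1)). simpl in *. lra.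
  - apply (weighted_bound _ 0 1); [apply per_cont_test | lra |]. intros t. rewrite E. unfold sq_dev. lra.
Qed.

Lemma moment_bound x1 x2 x3 j k : (k <= 2)%nat ->
  (forall e, e ^ j * (e - moment 1) ^ k = 0 + x1 * e + x2 * e ^ 2 + x3 * e ^ 3)%C ->
  Cmod (x1 * moment 1 + x2 * moment 2 + x3 * moment 3) <= 2.
Proof.
  intros Hk He. assert (B := mean_density_test_bound j k Hk).
  rewrite (mean_ext _ (fun t => density t * (0 + x1 * conj_cis t + x2 * conj_cis t ^ 2 + x3 * conj_cis t ^ 3))%C) in B
    by (intros; now rewrite He).
  rewrite mean_density_cubic in B.
  replace (x1 * moment 1 + x2 * moment 2 + x3 * moment 3)%C with
    (2 * (0 + (x1 * moment 1 + x2 * moment 2 + x3 * moment 3) / 2))%C by field.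
  rewrite Cmod_mult, Cmod_R, Rabs_pos_eq by lra. lra.
Qed.
End Circle.

Lemma homogeneous_bound n x : (forall r, 0 < r < 1 -> Cmod (r ^ n * x)%C <= 2) -> Cmod x <= 2.
Proof.
  intros H. apply (pow_mult_le_limit n). intros r Hr. specialize (H r Hr).
  rewrite Cmod_mult, Cmod_pow, Cmod_R, Rabs_pos_eq in H by lra. exact H.
Qed.

(** The six functionals are twice the means of [e ^ j * (e - m) ^ k] for
    [(j, k)] equal to (1,0), (2,0), (1,1), (3,0), (2,1), (1,2), up to a power
    of [r] that tends to 1. *)
Theorem caratheodory_bounds :
  Cmod (c 1%nat) <= 2 /\ Cmod (c 2%nat) <= 2 /\ Cmod (c 2%nat - c 1%nat * c 1%nat) <= 2 /\
  Cmod (c 3%nat) <= 2 /\ Cmod (c 3%nat - c 1%nat * c 2%nat) <= 2 /\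
  Cmod (c 3%nat - 2 * c 1%nat * c 2%nat + c 1%nat * c 1%nat * c 1%nat) <= 2.
Proof.
  repeat split.
  - apply (homogeneous_bound 1). intros r Hr.
    generalize (moment_bound r Hr 1 0 0 1 0 ltac:(lia)). unfold moment. intros B.
    replace (r ^ 1 * _)%C with (1 * (c 1%nat * r ^ 1) + 0 * (c 2%nat * r ^ 2) + 0 * (c 3%nat * r ^ 3))%C by ring.
    apply B. intros e. simpl. ring.
  - apply (homogeneous_bound 2). intros r Hr.
    generalize (moment_bound r Hr 0 1 0 2 0 ltac:(lia)). unfold moment. intros B.
    replace (r ^ 2 * _)%C with (0 * (c 1%nat * r ^ 1) + 1 * (c 2%nat * r ^ 2) + 0 * (c 3%nat * r ^ 3))%C by ring.
    apply B. intros e. simpl. ring.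
  - apply (homogeneous_bound 2). intros r Hr.
    generalize (moment_bound r Hr (- moment r 1) 1 0 1 1 ltac:(lia)). unfold moment. intros B.
    replace (r ^ 2 * _)%C with (- (c 1%nat * r ^ 1) * (c 1%nat * r ^ 1) + 1 * (c 2%nat * r ^ 2) + 0 * (c 3%nat * r ^ 3))%C by ring.
    apply B. intros e. simpl. ring.
  - apply (homogeneous_bound 3). intros r Hr.
    generalize (moment_bound r Hr 0 0 1 3 0 ltac:(lia)). unfold moment. intros B.
    replace (r ^ 3 * _)%C with (0 * (c 1%nat * r ^ 1) + 0 * (c 2%nat * r ^ 2) + 1 * (c 3%nat * r ^ 3))%C by ring.
    apply B. intros e. simpl. ring.
  - apply (homogeneous_bound 3). intros r Hr.
    generalize (moment_bound r Hr 0 (- moment r 1) 1 2 1 ltac:(lia)). unfold moment. intros B.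
    replace (r ^ 3 * _)%C with (0 * (c 1%nat * r ^ 1) + (- (c 1%nat * r ^ 1)) * (c 2%nat * r ^ 2) + 1 * (c 3%nat * r ^ 3))%C by ring.
    apply B. intros e. simpl. ring.
  - apply (homogeneous_bound 3). intros r Hr.
    generalize (moment_bound r Hr (moment r 1 * moment r 1) (- (2 * moment r 1)) 1 1 2 ltac:(lia)).
    unfold moment. intros B.
    replace (r ^ 3 * _)%C with ((c 1%nat * r ^ 1) * (c 1%nat * r ^ 1) * (c 1%nat * r ^ 1) +
      (- (2 * (c 1%nat * r ^ 1))) * (c 2%nat * r ^ 2) + 1 * (c 3%nat * r ^ 3))%C by ring.
    apply B. intros e. simpl. ring.
Qed.
End Caratheodory.

(** * Bounds and extremal functions for the class W *)

Definition W_weight (alpha : R) (n : nat) : R := INR (S n) * (1 + alpha * INR n).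

(** Taylor coefficients of [f' + alpha z f''] when [a] are those of [f]. *)
Definition W_coef (alpha : R) (a : nat -> C) (n : nat) : C := (W_weight alpha n * a (S n))%C.

Lemma W_weight_ge_1 alpha n : 0 <= alpha -> 1 <= W_weight alpha n.
Proof.
  intros Ha. unfold W_weight. rewrite S_INR. assert (P := pos_INR n).
  assert (Q : 0 <= alpha * INR n) by now apply Rmult_le_pos. nra.
Qed.

Lemma W_coef_inv alpha a n : 0 <= alpha -> a (S n) = (RtoC (/ W_weight alpha n) * W_coef alpha a n)%C.
Proof.
  intros Ha. assert (H := W_weight_ge_1 alpha n Ha). unfold W_coef. rewrite RtoC_inv by lra. field.
  intros X. apply RtoC_inj in X. lra.
Qed.

Lemma class_A_has_ps f : class_A f -> exists a, has_ps f a 1 /\ a 0%nat = 0 /\ a 1%nat = 1.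
Proof.
  intros [Hh [H0 H1]]. destruct (taylor f 1 Rlt_0_1 Hh) as [a [Ha _]]. exists a. split; auto. split.
  now rewrite <- (has_ps_0 f a 1 Rlt_0_1 Ha).
  rewrite <- H1, (has_ps_0 _ _ 1 Rlt_0_1 (has_ps_derive f a 1 Ha)). unfold cps_derive.
  replace (RtoC (INR 1)) with (RtoC 1) by reflexivity. ring.
Qed.

Lemma cps_plus a b z l m : cps a z l -> cps b z m -> cps (fun n => a n + b n)%C z (l + m)%C.
Proof. apply (is_pseries_plus (K := C_AbsRing) (V := C_NormedModule)). Qed.

Lemma W_coef_has_ps (alpha : R) f a : has_ps f a 1 ->
  has_ps (fun z => C_derive f z + alpha * z * C_derive (C_derive f) z)%C (W_coef alpha a) 1.
Proof.
  intros H z Hz.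
  assert (A := has_ps_derive _ _ _ H). assert (B := has_ps_derive _ _ _ A z Hz). specialize (A z Hz).
  rewrite cps_series in A, B. apply cps_series.
  assert (B' : cseries (fun n => match n with O => 0 | S m => alpha * z * (z ^ m * cps_derive (cps_derive a) m) end)%C
     (0 + alpha * z * C_derive (C_derive f) z)%C).
  { apply (cseries_shift (fun n => _)). now apply cseries_scal. }
  replace (C_derive f z + alpha * z * C_derive (C_derive f) z)%C with
   (C_derive f z + (0 + alpha * z * C_derive (C_derive f) z))%C by ring.
  generalize (cseries_plus _ _ _ _ A B'). apply cseries_ext. intros n. unfold W_coef, W_weight, cps_derive.
  rewrite RtoC_mult, RtoC_plus, RtoC_mult.
  destruct n. simpl. ring. rewrite Cpow_S. ring.
Qed.

Lemma Cmod_convex2 x y s t : 0 <= s -> 0 <= t -> Cmod x <= 2 -> Cmod y <= 2 ->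
  Cmod (s * x + t * y)%C <= 2 * (s + t).
Proof.
  intros Hs Ht Hx Hy. eapply Rle_trans. apply Cmod_triangle.
  rewrite !Cmod_mult, !Cmod_R, !Rabs_pos_eq by auto. nra.
Qed.

Lemma Cmod_convex3 x y z s t u : 0 <= s -> 0 <= t -> 0 <= u ->
  Cmod x <= 2 -> Cmod y <= 2 -> Cmod z <= 2 ->
  Cmod (s * x + t * y + u * z)%C <= 2 * (s + t + u).
Proof.
  intros Hs Ht Hu Hx Hy Hz. eapply Rle_trans. apply Cmod_triangle.
  assert (H := Cmod_convex2 x y s t Hs Ht Hx Hy).
  rewrite (Cmod_mult u), Cmod_R, (Rabs_pos_eq u) by auto. nra.
Qed.

(** After substituting [a n] in terms of the coefficients [c] of
    [f' + alpha z f''], each logarithmic coefficient is a combination with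
    nonnegative weights of functionals bounded in [caratheodory_bounds], and
    the weights sum to half of the claimed bound. Nonnegativity amounts to
    [K12] and [K123]. *)
Lemma log_coeff_bounds alpha f : 0 <= alpha -> class_W alpha f ->
     Cmod (log_coeff f 1) <= 1 / (2 * (1 + alpha)) /\
     Cmod (log_coeff f 2) <= 1 / (3 * (1 + 2 * alpha)) /\
     Cmod (log_coeff f 3) <= 1 / (4 * (1 + 3 * alpha)).
Proof.
  intros Ha [HA HW]. destruct (class_A_has_ps f HA) as [a [Hf [a0 a1]]].
  destruct (log_coeff_values f a Hf a0 a1) as [-> [-> ->]].
  assert (Hp := W_coef_has_ps alpha f a Hf).
  assert (c0 : W_coef alpha a 0 = 1).
  { unfold W_coef, W_weight. rewrite a1. simpl. replace (1 * (1 + alpha * 0)) with 1 by ring. ring. }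
  destruct (caratheodory_bounds _ _ Hp c0 HW) as (B1 & B2 & B2' & B3 & B3' & B3'').
  set (c := W_coef alpha a) in *.
  assert (E2 := W_coef_inv alpha a 1 Ha). assert (E3 := W_coef_inv alpha a 2 Ha).
  assert (E4 := W_coef_inv alpha a 3 Ha).
  replace (W_weight alpha 1) with (2 * (1 + alpha)) in E2 by (unfold W_weight; simpl; ring).
  replace (W_weight alpha 2) with (3 * (1 + 2 * alpha)) in E3 by (unfold W_weight; simpl; ring).
  replace (W_weight alpha 3) with (4 * (1 + 3 * alpha)) in E4 by (unfold W_weight; simpl; ring).
  fold c in E2, E3, E4.
  rewrite E2, E3, E4.
  set (k1 := / (2 * (1 + alpha))). set (k2 := / (3 * (1 + 2 * alpha))). set (k3 := / (4 * (1 + 3 * alpha))).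
  assert (K1 : 0 < k1) by (apply Rinv_0_lt_compat; lra).
  assert (K12 : 4 * (k1 * k1) <= 3 * k2).
  { unfold k1, k2. rewrite <- Rinv_mult.
    replace (4 * / (2 * (1 + alpha) * (2 * (1 + alpha)))) with (/ ((1 + alpha) * (1 + alpha))) by (field; lra).
    replace (3 * / (3 * (1 + 2 * alpha))) with (/ (1 + 2 * alpha)) by (field; lra).
    apply Rinv_le_contravar; nra. }
  assert (K123 : k1 * k2 <= k3).
  { unfold k1, k2, k3. rewrite <- Rinv_mult. apply Rinv_le_contravar; nra. }
  clearbody c. clear E2 E3 E4.
  unfold Rdiv. rewrite !Rmult_1_l. fold k1 k2 k3. clearbody k1 k2 k3.
  split; [|split].
  - replace (k1 * c 1%nat / 2)%C with ((k1 / 2)%R * c 1%nat + 0 * 0)%C by (rewrite RtoC_div by lra; field).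
    eapply Rle_trans. apply Cmod_convex2; auto. lra. lra. rewrite Cmod_0; lra. lra.
  - replace ((k2 * c 2%nat - k1 * c 1%nat * (k1 * c 1%nat) / 2) / 2)%C with
      ((k2 / 2 - k1 * k1 / 4)%R * c 2%nat + (k1 * k1 / 4)%R * (c 2%nat - c 1%nat * c 1%nat))%C.
    2: { rewrite RtoC_minus, !RtoC_div, RtoC_mult by lra. field. }
    eapply Rle_trans. apply Cmod_convex2; auto; nra. lra.
  - replace (_ / 2)%C with
     (((k3 - k1 * k2 + k1 * k1 * k1 / 3) / 2)%R * c 3%nat +
      ((k1 * k2 - 2 * (k1 * k1 * k1 / 3)) / 2)%R * (c 3%nat - c 1%nat * c 2%nat) +
      (k1 * k1 * k1 / 6)%R * (c 3%nat - 2 * c 1%nat * c 2%nat + c 1%nat * c 1%nat * c 1%nat))%C.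
    2: { repeat first [rewrite RtoC_div by lra | rewrite RtoC_plus | rewrite RtoC_minus | rewrite RtoC_mult]. field. }
    assert (K111 : 0 <= k1 * k1 * k1) by (repeat apply Rmult_le_pos; lra).
    eapply Rle_trans. apply Cmod_convex3; auto; nra. lra.
Qed.

(** [1 + w * (2 / (1 - w))] is the Cayley transform [(1 + w) / (1 - w)], with
    real part [(1 - |w| ^ 2) / |1 - w| ^ 2]. *)
Lemma Re_cayley w : Cmod w < 1 -> 0 < Re (1 + w * (2 / (1 - w))).
Proof.
  intros Hw. assert (Hw0 := Cmod_ge_0 w).
  assert (H1 : (1 - w)%C <> 0).
  { apply Cmod_gt_0. assert (L := Cmod_minus_lower 1 w). rewrite Cmod_1 in L. lra. }
  assert (H2 : 0 < Cmod (1 - w) ^ 2) by (apply pow_lt; now apply Cmod_gt_0).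
  assert (H3 : Cconj (1 - w) <> 0) by (apply Cmod_gt_0; rewrite Cmod_conj; now apply Cmod_gt_0).
  replace (1 + w * (2 / (1 - w)))%C with ((/ Cmod (1 - w) ^ 2)%R * ((1 + w) * Cconj (1 - w)))%C.
  2: { rewrite RtoC_inv, Cmod2_conj by lra. field. auto. }
  rewrite re_scal_l. apply Rmult_lt_0_compat. now apply Rinv_0_lt_compat.
  assert (E := Cmod2_alt w). replace (Re _) with (1 - Cmod w ^ 2). nra.
  rewrite E. destruct w as [x y]. unfold Re, Im; simpl. ring.
Qed.

Lemma one_ps z : cps (fun n => match n with O => 1 | S _ => 0 end) z 1.
Proof.
  set (one := fun n : nat => match n with O => RtoC 1 | S _ => RtoC 0 end).
  assert (H : cseries (fun n => z ^ n * one n)%C (z ^ 0 * one 0%nat + 0)%C).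
  { apply (cseries_shift (fun n => z ^ n * one n)%C). generalize cseries_0. apply cseries_ext. intros n. simpl. ring. }
  apply cps_series. replace (RtoC 1) with (z ^ 0 * one 0%nat + 0)%C by (simpl; ring). exact H.
Qed.

(** Prescribe [f' + alpha z f'' = (1 + z ^ n) / (1 - z ^ n)] and solve for the
    coefficients of [f]. Written as [1 + z ^ n * u z], the right-hand side
    shows its first coefficients: those of [u], whose first one is 2, shifted
    by [n]. *)
Lemma extremal_function alpha n : 0 <= alpha -> (0 < n)%nat ->
  exists f a, class_W alpha f /\ has_ps f a 1 /\ a 0%nat = 0 /\ a 1%nat = 1 /\
    (forall k, (0 < k < n)%nat -> a (S k) = 0) /\
    a (S n) = RtoC (2 / W_weight alpha n).
Proof.
  intros Ha Hn.
  assert (Hpow : forall z, Cmod z < 1 -> Cmod (z ^ n) < 1).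
  { intros z Hz. rewrite Cmod_pow. destruct n as [|m]; [lia|]. simpl.
    assert (H := Cmod_ge_0 z). assert (Cmod z ^ m <= 1) by (rewrite <- (pow1 m); apply pow_incr; lra).
    assert (0 <= Cmod z ^ m) by now apply pow_le. nra. }
  set (u := fun z => (2 / (1 - z ^ n))%C).
  destruct (taylor u 1 Rlt_0_1) as [b [Hb _]].
  { intros z Hz. apply cdiff_div. apply cdiff_const.
    apply cdiff_minus. apply cdiff_const. apply cdiff_pow, cdiff_id.
    apply Cmod_gt_0. assert (L := Cmod_minus_lower 1 (z ^ n)%C). rewrite Cmod_1 in L.
    specialize (Hpow z Hz). lra. }
  assert (b0 : b 0%nat = 2).
  { rewrite <- (has_ps_0 u b 1 Rlt_0_1 Hb). unfold u. destruct n as [|m]; [lia|]. rewrite Cpow_S, Cmult_0_l. field. }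
  set (c := fun k => (match k with O => 1 | S _ => 0 end + (PS_incr_n (V := C_NormedModule) b n k : C))%C).
  assert (Hc : has_ps (fun z => 1 + z ^ n * u z)%C c 1).
  { intros z Hz. apply cps_plus. apply one_ps. rewrite <- pow_n_Cpow.
    apply (is_pseries_incr_n (K := C_AbsRing) (V := C_NormedModule) b n z (u z)). now apply Hb. }
  assert (c0 : c 0%nat = 1).
  { unfold c. rewrite PS_incr_n_simplify. destruct (Compare_dec.le_lt_dec n 0); [lia|]. unfold zero; simpl. ring. }
  assert (ck : forall k, (0 < k < n)%nat -> c k = 0).
  { intros k Hk. unfold c. rewrite PS_incr_n_simplify. destruct (Compare_dec.le_lt_dec n k); [lia|].
    destruct k; [lia|]. unfold zero; simpl. ring. }
  assert (cn : c n = 2).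
  { unfold c. rewrite PS_incr_n_simplify. destruct (Compare_dec.le_lt_dec n n); [|lia].
    rewrite Nat.sub_diag, b0. destruct n; [lia|]. ring. }
  clearbody c.
  set (d := W_weight alpha). assert (Hd : forall k, 1 <= d k) by (intros; now apply W_weight_ge_1).
  set (a := fun k => match k with O => RtoC 0 | S m => (RtoC (/ d m) * c m)%C end).
  destruct (has_ps_bounded_coefs _ _ a 1 Hc) as [f Hf].
  { exists 1. split. lra. intros k. change (a (S k)) with (RtoC (/ d k) * c k)%C. rewrite Cmod_mult, Cmod_R.
    specialize (Hd k). apply Rmult_le_compat_r. apply Cmod_ge_0.
    rewrite Rabs_pos_eq. rewrite <- Rinv_1. apply Rinv_le_contravar; lra. left; apply Rinv_0_lt_compat; lra. }
  assert (a1 : a 1%nat = 1).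
  { simpl. rewrite c0. unfold d, W_weight. simpl. replace (1 * (1 + alpha * 0)) with 1 by ring. rewrite Rinv_1. ring. }
  assert (HW : forall k, W_coef alpha a k = c k).
  { intros k. unfold W_coef. change (a (S k)) with (RtoC (/ d k) * c k)%C. fold d. specialize (Hd k).
    rewrite RtoC_inv by lra. field. intros X. apply RtoC_inj in X. lra. }
  exists f, a. split; [|split; [exact Hf|split; [reflexivity|split; [exact a1|split]]]].
  - split.
    + split. intros z Hz. exact (has_ps_cdiff f a 1 z Hf Hz). split. exact (has_ps_0 f a 1 Rlt_0_1 Hf).
      rewrite (has_ps_0 _ _ 1 Rlt_0_1 (has_ps_derive f a 1 Hf)). unfold cps_derive. rewrite a1.
      replace (RtoC (INR 1)) with (RtoC 1) by reflexivity. ring.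
    + intros z Hz.
      replace (C_derive f z + alpha * z * C_derive (C_derive f) z)%C with (1 + z ^ n * u z)%C.
      apply Re_cayley. now apply Hpow.
      apply (cps_unique c z). now apply Hc.
      exact (has_ps_ext_coefs _ _ c 1 HW (W_coef_has_ps alpha f a Hf) z Hz).
  - intros k Hk. change (a (S k)) with (RtoC (/ d k) * c k)%C. rewrite ck by auto. ring.
  - change (a (S n)) with (RtoC (/ d n) * c n)%C. rewrite cn, <- RtoC_mult. f_equal. unfold Rdiv, d. ring.
Qed.

Theorem theorem3p1 (alpha : R) (Halpha : 0 <= alpha) :
  (forall f : C -> C, class_W alpha f ->
     Cmod (log_coeff f 1) <= 1 / (2 * (1 + alpha)) /\
     Cmod (log_coeff f 2) <= 1 / (3 * (1 + 2 * alpha)) /\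
     Cmod (log_coeff f 3) <= 1 / (4 * (1 + 3 * alpha))) /\
  (exists f : C -> C, class_W alpha f /\
     Cmod (log_coeff f 1) = 1 / (2 * (1 + alpha))) /\
  (exists f : C -> C, class_W alpha f /\
     Cmod (log_coeff f 2) = 1 / (3 * (1 + 2 * alpha))) /\
  (exists f : C -> C, class_W alpha f /\
     Cmod (log_coeff f 3) = 1 / (4 * (1 + 3 * alpha))).
Proof.
  split; [intros f; now apply log_coeff_bounds|].
  assert (V : forall x y : R, 0 < y -> x = 2 * y -> Cmod (RtoC x / 2) = y).
  { intros x y Hy ->. replace (RtoC (2 * y) / 2)%C with (RtoC y) by (rewrite RtoC_mult; field).
    rewrite Cmod_R. apply Rabs_pos_eq. lra. }
  split; [|split].
  - destruct (extremal_function alpha 1 Halpha) as [f [a [HW [Hf [a0 [a1 [_ an]]]]]]]; [lia|].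
    exists f. split; auto. destruct (log_coeff_values f a Hf a0 a1) as [-> _].
    rewrite an. apply V. apply Rdiv_lt_0_compat; lra. unfold W_weight. simpl. field. lra.
  - destruct (extremal_function alpha 2 Halpha) as [f [a [HW [Hf [a0 [a1 [ak an]]]]]]]; [lia|].
    exists f. split; auto. destruct (log_coeff_values f a Hf a0 a1) as [_ [-> _]].
    rewrite an, (ak 1%nat) by lia.
    replace (_ - 0 * 0 / 2)%C with (RtoC (2 / W_weight alpha 2)) by field.
    apply V. apply Rdiv_lt_0_compat; lra. unfold W_weight. simpl. field. lra.
  - destruct (extremal_function alpha 3 Halpha) as [f [a [HW [Hf [a0 [a1 [ak an]]]]]]]; [lia|].
    exists f. split; auto. destruct (log_coeff_values f a Hf a0 a1) as [_ [_ ->]].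
    rewrite an, (ak 1%nat), (ak 2%nat) by lia.
    replace (_ - 0 * 0 + 0 * 0 * 0 / 3)%C with (RtoC (2 / W_weight alpha 3)) by field.
    apply V. apply Rdiv_lt_0_compat; lra. unfold W_weight. simpl. field. lra.
Qed.
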